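(* Assume (A) or (B), with $\alpha=a$ in case (A) and $\alpha=b$ in case (B). Let $p>p_*(\alpha):=1+\frac{2}{n+\alpha}$ and set $r_*:=\frac{n+\alpha}{2}(p-1)>1$. Then: (i) There is $\delta>0$ such that for every nonnegative $u_0\in L^\infty(\mathbb{R}^n)\cap L^{r_*,\infty}(w)$ with $\|u_0\|_{L^{r_*,\infty}(w)}<\delta$, there exists a unique global-in-time solution $u$ of problem (P), and it satisfies $$\sup_{t>0}(1+t)^{\frac{n+\alpha}{2}\left(\frac1{r_*}-\frac1q\right)}\|u(t)\|_{L^{q,\infty}(w)}<\infty\quad\text{for all } r_*\le q\le\infty.$$ (ii) Let $1\le r\le r_*$. There is $\delta>0$ such that for every nonnegative $u_0\in L^\infty(\mathbb{R}^n)\cap L^r(w)$ with $\|u_0\|_{L^r(w)}^{r/r_*}\|u_0\|_{\infty}^{1-r/r_*}<\delta$, there exists a unique global-in-time solution $u$ of (P), and it satisfies $$\sup_{t>0}(1+t)^{\frac{n+\alpha}{2}\left(\frac1{r}-\frac1q\right)}\|u(t)\|_{L^{q}(w)}<\infty\quad\text{for all } r\le q\le\infty.$$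
   Context: (A): $w(x)=|x_1|^a$ on $\mathbb{R}^n$ with $a\in[0,1)$; (B): $w(x)=|x|^b$ with $b\in[0,n)$; $n\ge1$. Problem (P): $\partial_t u-w^{-1}\operatorname{div}(w\nabla u)=u^p$ in $\mathbb{R}^n\times(0,\infty)$, $u(\cdot,0)=u_0\ge0$. $\Gamma$ is the fundamental solution of $\partial_t v-w^{-1}\operatorname{div}(w\nabla v)=0$ with pole at $(y,0)$, assumed to satisfy (K1) $\int\Gamma(x,y,t)w(x)dx=\int\Gamma(x,y,t)w(y)dy=1$; (K2) $\Gamma(x,y,t)=\int\Gamma(x,\xi,t-s)\Gamma(\xi,y,s)w(\xi)d\xi$ for $t>s>0$; (K3) two-sided Gaussian bounds $c_*e^{-|x-y|^2/(c_*t)}\le \sqrt{w(B(x,\sqrt t))w(B(y,\sqrt t))}\,\Gamma(x,y,t)\le C_*e^{-|x-y|^2/(C_*t)}$ with $c_*,C_*$ depending on $n,\alpha$. A solution in $\mathbb{R}^n\times(0,T)$ is a nonnegative measurable $u\in L^\infty(0,T;L^\infty)$ with $u(x,t)=\int\Gamma(x,y,t)u_0(y)w(y)dy+\int_0^t\int\Gamma(x,y,t-s)u(y,s)^pw(y)dyds<\infty$ for a.e. $x$ and all $t\in(0,T)$; global-in-time means $T=\infty$. Weighted spaces: $\|f\|_{L^r(w)}=(\int|f|^rw\,dx)^{1/r}$; $\mu_f(\lambda)=w(\{|f|>\lambda\})$; $f^*(s)=\inf\{\lambda>0:\mu_f(\lambda)\le s\}$; $\|f\|_{L^{r,\sigma}(w)}=(\int_0^\infty[s^{1/r}f^*(s)]^\sigma\frac{ds}{s})^{1/\sigma}$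 for $1\le\sigma<\infty$ and $\sup_{s>0}s^{1/r}f^*(s)$ for $\sigma=\infty$; $L^{\infty,\infty}(w)=L^\infty$. *)

(* Defs.v *)
(* Euclidean space R^n is modelled as
   n.-tuple R with its product (= Borel) sigma-algebra. *)
From mathcomp Require Import all_boot all_order all_algebra.
From mathcomp Require Import all_classical all_reals all_analysis.
From mathcomp Require Import ess_sup_inf.

Set Implicit Arguments.
Unset Strict Implicit.
Unset Printing Implicit Defensive.

Import Order.TTheory GRing.Theory Num.Theory.
Import numFieldNormedType.Exports.

Local Open Scope classical_set_scope.
Local Open Scope ring_scope.

Definition enorm {R : realType} {n : nat} (x : n.-tuple R) : R :=
  Num.sqrt (\sum_(i < n) tnth x i ^+ 2).

Definition edist {R : realType} {n : nat} (x y : n.-tuple R) : R :=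
  Num.sqrt (\sum_(i < n) (tnth x i - tnth y i) ^+ 2).

Definition weight {R : realType} {n : nat} (caseA : bool) (alpha : R)
  (x : n.-tuple R) : R :=
  if caseA then `|nth 0 (x : seq R) 0| `^ alpha else enorm x `^ alpha.

(* mu is Lebesgue measure on R^n: it gives boxes their volume (this determines
   mu uniquely on the Borel sets of R^n). *)
Definition is_lebesgue_Rn {R : realType} {n : nat}
  (mu : {measure set (n.-tuple R) -> \bar R}) : Prop :=
  forall a b : n.-tuple R, (forall i, tnth a i <= tnth b i) ->
    mu [set x | forall i, tnth a i < tnth x i <= tnth b i] =
    (\prod_(i < n) (tnth b i - tnth a i))%:E.

Section weighted.
Context {R : realType} {n : nat}.
Variable mu : {measure set (n.-tuple R) -> \bar R}.
Variable w : n.-tuple R -> R.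

Definition wmeas (A : set (n.-tuple R)) : \bar R := (\int[mu]_(x in A) (w x)%:E)%E.

Definition distrib (f : n.-tuple R -> R) (lam : R) : \bar R :=
  wmeas [set x | lam < `|f x|].

Definition rearr (f : n.-tuple R -> R) (s : R) : \bar R :=
  ereal_inf [set lam%:E | lam in [set lam : R | 0 < lam /\ (distrib f lam <= s%:E)%E]].

Definition Linf (f : n.-tuple R -> R) : \bar R := ess_sup mu (fun x => (`|f x|)%:E).

Definition Lweak (q : \bar R) (f : n.-tuple R -> R) : \bar R :=
  match q with
  | q'%:E => ereal_sup [set ((s `^ q'^-1)%:E * rearr f s)%E | s in [set s : R | 0 < s]]
  | +oo%E => Linf f
  | -oo%E => 0%E
  end.

Definition Lw (q : \bar R) (f : n.-tuple R -> R) : \bar R :=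
  match q with
  | q'%:E => poweR (\int[mu]_x ((`|f x| `^ q' * w x)%:E))%E q'^-1
  | +oo%E => Linf f
  | -oo%E => 0%E
  end.

Definition kernel_assumptions (Gamma : n.-tuple R -> n.-tuple R -> R -> R) : Prop :=
  measurable_fun [set: (n.-tuple R * n.-tuple R) * R]
    (fun z => Gamma z.1.1 z.1.2 z.2) /\
  (forall x y t, 0 < t ->
     (\int[mu]_x' ((Gamma x' y t * w x')%:E))%E = 1%E /\
     (\int[mu]_y' ((Gamma x y' t * w y')%:E))%E = 1%E) /\
  (forall x y t s, 0 < s -> s < t ->
     (Gamma x y t)%:E = (\int[mu]_xi ((Gamma x xi (t - s) * Gamma xi y s * w xi)%:E))%E) /\
  (exists cs Cs : R, 0 < cs /\ 0 < Cs /\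
     forall x y t, 0 < t ->
       let wB z := fine (wmeas [set z' | edist z z' < Num.sqrt t]) in
       cs * expR (- (edist x y ^+ 2) / (cs * t))
         <= Num.sqrt (wB x * wB y) * Gamma x y t
         <= Cs * expR (- (edist x y ^+ 2) / (Cs * t))).

Definition is_solution (Gamma : n.-tuple R -> n.-tuple R -> R -> R) (p : R)
  (T : \bar R) (u0 : n.-tuple R -> R) (u : n.-tuple R -> R -> R) : Prop :=
  measurable_fun [set z : n.-tuple R * R | 0 < z.2 /\ (z.2%:E < T)%E]
    (fun z => u z.1 z.2) /\
  (forall x t, 0 < t -> (t%:E < T)%E -> 0 <= u x t) /\
  (exists M : R, \forall t \ae (@lebesgue_measure R),
     0 < t -> (t%:E < T)%E -> (Linf (fun x => u x t) <= M%:E)%E) /\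
  (forall t, 0 < t -> (t%:E < T)%E ->
     \forall x \ae mu,
       (u x t)%:E =
       (\int[mu]_y ((Gamma x y t * u0 y * w y)%:E) +
        \int[(@lebesgue_measure R)]_(s in [set s : R | 0 < s < t]%R)
           \int[mu]_y ((Gamma x y (t - s) * (u y s `^ p) * w y)%:E))%E).

End weighted.

Definition einv {R : realType} (q : \bar R) : R :=
  match q with q'%:E => q'^-1 | _ => 0 end.

(* Main.v *)
(* Work with the semigroup G(t) f (x) = \int Gamma(x,y,t) f(y) w(y) dy.  By (K1)
   it preserves constants and the mass \int f w; by (K3), since every ball of
   radius sqrt t has w-measure at least c t^((n+alpha)/2), it satisfies
   G(t) f <= D t^(-(n+alpha)/2) \int f w.
   For 1 <= th < p the function U(t) = 2 (G(t) u0^th)^(1/th) is a supersolution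
   of the integral equation as soon as
     2^p ||G(t) u0^th||^(1-1/th) \int_0^t ||G(s) u0^th||^(p/th-1) ds <= 1
   (sup norms): Jensen gives G(t) u0 <= U(t)/2, and the semigroup law turns
   \int_0^t G(t-s) U(s)^p ds into G(t) u0^th times the integral above.  The
   condition holds for small data with th = 1 if r < rs, where the integral
   converges at infinity, and with 1 < th < min(p, rs) for data in weak
   L^(rs), where it is scale invariant.  Monotone iteration below U gives a
   solution, to which the decay of U transfers; two bounded solutions agree
   because their difference is O(t^j / j!) for every j. *)

Require Import Defs.
From HB Require Import structures.
From mathcomp Require Import all_boot all_order all_algebra.
From mathcomp Require Import all_classical all_reals all_analysis.
From mathcomp Require Import ess_sup_inf measurable_realfun.
From mathcomp Require Import ring lra zify.

Set Implicit Arguments.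
Unset Strict Implicit.
Unset Printing Implicit Defensive.

Import Order.TTheory GRing.Theory Num.Theory.
Import numFieldNormedType.Exports.
Local Open Scope classical_set_scope.
Local Open Scope ring_scope.

(** * Powers of real numbers *)

(** Write kap = (n+alpha)/2, so that rs = kap (p-1). For u0 in L^r(w), r < rs, the sup norm of G(s)
    u0 is at most min(A, G s^(-kap/r)), where A is the sup norm of u0 and G a constant. Its power
    p-1 is bounded near 0 and decays like s^(-rs/r) with rs/r > 1, so th = 1 suffices; splitting at
    a suitable time yields exactly the product of norms in (ii). At r = rs the decay degrades to 1/s
    and this bound is no longer integrable. Taking th > 1 moves part of the decay out of the
    integral: the integrand becomes s^(c-1) with c = (th-1)/(p-1) > 0, and the growth t^c is
    cancelled by t^(-c) in front. The restriction th < rs is what allows u0^th, for u0 in weak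
    L^(rs), to be split into a bounded part and a w-integrable tail. The endpoint r = rs of (ii)
    uses the same th, since L^(rs) lies in weak L^(rs). The two weights are treated together through
    w(x) >= |x_1|^alpha. Powers of 1+t arise because U stays below 2A for small t; the norms with r
    < q < oo follow by interpolation between the L^r and sup bounds. *)

Lemma powR2_lt1 (R : realType) (x : R) : x < 0 -> 2 `^ x < 1.
Proof.
move=> x0; have : 2 `^ x <= 2 `^ 0 by rewrite ler_powR ?ler1n// ltW.
rewrite powRr0 le_eqVlt => /orP[|//]; rewrite powR_eq1 => /or3P[].
- by rewrite gt_eqF// ltr1n.
- by rewrite ltNge ler0n.
- by rewrite lt_eqF.
Qed.

(** Young's inequality with exponents m and m/(m-1), applied to x and c^(m-1), is exactly this
    convexity bound; it includes x = 0. The case m = 1, without a finite conjugate exponent, is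
    split off. *)
Lemma powR_tangent (R : realType) (m x c : R) : 1 <= m -> 0 <= x -> 0 < c ->
  c `^ m + m * c `^ (m - 1) * (x - c) <= x `^ m.
Proof.
move=> m1 x0 c0.
have [->|mN1] := eqVneq m 1.
  by rewrite subrr powRr0 !powRr1 ?(ltW c0)// !mul1r addrC subrK.
have m1' : 1 < m by rewrite lt_neqAle eq_sym mN1.
have m0 : 0 < m by rewrite (lt_trans _ m1').
have cm : c `^ m = c `^ (m - 1) * c.
  by rewrite -[X in _ = _ * X]powRr1 ?(ltW c0)// -powRD ?subrK ?(gt_eqF c0) ?implybT.
have q0 : 0 < m / (m - 1) by rewrite divr_gt0 ?subr_gt0.
have e1 : m^-1 + (m / (m - 1))^-1 = 1.
  by rewrite invf_div; field; rewrite gt_eqF.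
have /= := @conjugate_powR R x (c `^ (m - 1)) m (m / (m - 1)) x0 (powR_ge0 _ _) m0 q0 e1.
rewrite -powRrM mulrCA divff ?mulr1 ?subr_eq0// => h.
have {h} := ler_wpM2l (ltW m0) h.
rewrite mulrDr [m * (_ / _)]mulrC divfK ?gt_eqF// invf_div [c `^ m * _]mulrA.
rewrite [m * (_ / m)]mulrC divfK ?gt_eqF// cm => h.
suff -> : c `^ (m - 1) * c + m * c `^ (m - 1) * (x - c) = m * (x * c `^ (m - 1)) - c `^ (m - 1) * c * (m - 1) by rewrite lerBlDr.
ring.
Qed.

(** The tangent line at the larger of the two points gives the bound, since its slope is at most p
    M^(p-1). *)
Lemma powR_lipschitz (R : realType) (p M a b : R) : 1 <= p -> 0 <= a <= M -> 0 <= b <= M ->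
  `|a `^ p - b `^ p| <= p * M `^ (p - 1) * `|a - b|.
Proof.
move=> p1; wlog ab : a b / b <= a.
  move=> H ha hb; have [ba|/ltW ab] := leP b a; first exact: H.
  by rewrite distrC [X in _ * X]distrC H.
move=> /andP[a0 aM] /andP[b0 bM].
have p0 : 0 <= p by rewrite (le_trans _ p1).
rewrite !ger0_norm ?subr_ge0//; last by rewrite ge0_ler_powR.
have [a0'|a_le0] := ltP 0 a; last first.
  have a00 : a = 0 by apply/eqP; rewrite eq_le a_le0.
  have -> : b = a by apply/eqP; rewrite eq_le ab a00 b0.
  by rewrite !subrr mulr0.
have := @powR_tangent R p b a p1 b0 a0'.
rewrite -[in X in X -> _](opprB a b) mulrN lerBlDl -lerBlDr => /le_trans; apply.
by rewrite ler_wpM2r ?subr_ge0// ler_wpM2l// ge0_ler_powR ?subr_ge0// nnegrE (le_trans a0).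
Qed.

Lemma integral_powR (R : realType) (a b c : R) : 0 < a -> a < b -> c != 0 ->
  (\int[lebesgue_measure]_(s in `[a, b]) (s `^ (c - 1))%:E)%E = ((b `^ c - a `^ c) / c)%:E.
Proof.
move=> a0 ab c0.
have dP : forall s : R, 0 < s -> is_derive s 1 (fun x : R => c^-1 * x `^ c) (s `^ (c - 1)).
  move=> s s0; have h := is_derive1_powR c s0.
  have := @is_deriveZ R R R^o (fun x => x `^ c) c^-1 s 1 _ h.
  by rewrite /GRing.scale /= mulrA mulVf// mul1r.
have cP : forall s : R, 0 < s -> {for s, continuous (fun x : R => c^-1 * x `^ c)}.
  move=> s s0; apply: differentiable_continuous; apply/derivable1_diffP.
  by have [] := dP s s0.
rewrite (@continuous_FTC2 R (fun s => s `^ (c - 1)) (fun x : R => c^-1 * x `^ c) a b ab).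
- by rewrite -EFinB -mulrBr mulrC.
- apply: continuous_in_subspaceT => s; rewrite inE/= in_itv/= => /andP[as_ _].
  apply: differentiable_continuous; apply/derivable1_diffP.
  by have [] := is_derive1_powR (c - 1) (lt_le_trans a0 as_).
- split.
  + by move=> s; rewrite in_itv/= => /andP[as_ _]; have [] := dP s (lt_trans a0 as_).
  + by apply: cvg_at_right_filter; exact: cP.
  + by apply: cvg_at_left_filter; apply: cP; exact: lt_trans ab.
- move=> s; rewrite in_itv/= => /andP[as_ _]; rewrite derive1E.
  by have [_ ->] := dP s (lt_trans a0 as_).
Qed.
(** The integrand may be singular at 0, so the interval is exhausted by compact ones and monotone
    convergence passes the bound to the limit. *)
Lemma le_integral_powR_0 (R : realType) (t c : R) : 0 < t -> 0 < c ->
  (\int[lebesgue_measure]_(s in `]0%R, t[) (s `^ (c - 1))%:E <= (t `^ c / c)%:E)%E.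
Proof.
move=> t0 c0.
have mf D : measurable_fun D (EFin \o (fun s : R => s `^ (c - 1))).
  by apply/measurable_EFinP; apply: measurable_funTS; exact: measurable_powR.
rewrite -(integral_itv_bndoo false false)//.
(* [i.+2] keeps the left end strictly below [t], as [integral_powR] requires. *)
pose F i := `[t / i.+2%:R, t]%classic.
have -> : `]0, t]%classic = \bigcup_i F i.
  apply/seteqP; split => s /=; rewrite in_itv/=.
    move=> /andP[s0 st].
    exists (Num.truncn (t / s)) => //=.
    rewrite /F/= in_itv/= st andbT ler_pdivrMr ?ltr0n// mulrC -ler_pdivrMr//.
    by rewrite (le_trans (ltW (truncnS_gt _)))// ler_nat.
  move=> [i _]; rewrite /F/= in_itv/= => /andP[h ->]; rewrite andbT.
  by rewrite (lt_le_trans _ h)// divr_gt0.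
have cv : (\int[lebesgue_measure]_(x in F i) (x `^ (c - 1))%:E)%E @[i --> \oo] -->
   (\int[lebesgue_measure]_(x in \bigcup_i F i) (x `^ (c - 1))%:E)%E.
  apply: ge0_nondecreasing_set_cvg_integral => //.
  - move=> i j ij; rewrite subsetEset => s; rewrite /F/= !in_itv/= => /andP[h ->].
    rewrite andbT (le_trans _ h)// ler_pM2l// lef_pV2 ?posrE ?ltr0n// ler_nat; lia.
  - by move=> i; exact: measurable_itv.
  - by move=> i; exact: (mf (F i)).
  - by move=> i x _; rewrite lee_fin powR_ge0.
rewrite -(cvg_lim _ cv)//; apply: lime_le; first by apply/cvg_ex; eexists; exact: cv.
apply: nearW => i.
rewrite integral_powR ?gt_eqF ?divr_gt0 ?ltr_pdivrMr ?ltr_pMr ?ltr1n//.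
by rewrite lee_fin ler_pM2r ?invr_gt0// gerBl; exact: powR_ge0.
Qed.

Lemma le_integral_powR_infty (R : realType) (a b c : R) : 0 < a -> a < b -> c < 0 ->
  (\int[lebesgue_measure]_(s in `[a, b]) (s `^ (c - 1))%:E <= (a `^ c / - c)%:E)%E.
Proof.
move=> a0 ab c0; rewrite integral_powR ?lt_eqF// lee_fin.
rewrite -mulrNN -invrN ler_pM2r ?invr_gt0 ?oppr_gt0// opprB gerBl; exact: powR_ge0.
Qed.

Lemma cvg_nondecreasing_powR (R : realType) (p : R) (u : R ^nat) (l : R) : 1 <= p ->
  (forall n, 0 <= u n <= l) -> u @ \oo --> l -> (u n `^ p) @[n --> \oo] --> l `^ p.
Proof.
move=> p1 ul cu.
have p0 : 0 <= p by rewrite (le_trans _ p1).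
apply: (@squeeze_cvgr _ _ _ _ (fun n => l `^ p - p * l `^ (p - 1) * (l - u n)) (fun=> l `^ p)).
- apply: nearW => n; have /andP[u0 ulen] := ul n.
  have l0 : 0 <= l by rewrite (le_trans u0).
  rewrite ge0_ler_powR ?nnegrE ?andbT//.
  have := @powR_lipschitz R p l l (u n) p1; rewrite lexx l0 u0 ulen => /(_ isT isT).
  rewrite !ger0_norm ?subr_ge0 ?ge0_ler_powR ?nnegrE// => h.
  by rewrite lerBlDr -lerBlDl.
- have c0 : (l `^ p - p * l `^ (p - 1) * (l - u n)) @[n --> \oo] --> l `^ p - p * l `^ (p - 1) * (l - l).
    apply: cvgB; first exact: cvg_cst.
    apply: cvgM; first exact: cvg_cst.
    by apply: cvgB => //; exact: cvg_cst.
  by rewrite subrr mulr0 subr0 in c0.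
- exact: cvg_cst.
Qed.

Lemma cvg_integral_nondecreasing d (T : measurableType d) (R : realType)
    (mu : {measure set T -> \bar R}) (g : (T -> \bar R)^nat) (f : T -> \bar R) :
  (forall n, measurable_fun setT (g n)) -> (forall n x, 0 <= g n x)%E ->
  (forall x, {homo g^~ x : n m / (n <= m)%N >-> (n <= m)%E}) ->
  (forall x, g n x @[n --> \oo] --> f x) ->
  (\int[mu]_x g n x)%E @[n --> \oo] --> (\int[mu]_x f x)%E.
Proof.
move=> mg g0 ndg gf.
have -> : (\int[mu]_x f x = \int[mu]_x limn (g^~ x))%E.
  by apply: eq_integral => x _; rewrite (cvg_lim _ (gf x)).
exact: cvg_monotone_convergence.
Qed.

(** The scale invariant case: K t^(-th/(p-1)) is the sup bound for the flow of u0^th with u0 in weak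
    L^(rs). With c = (th-1)/(p-1) the integrand is a multiple of s^(c-1) and the prefactor a
    multiple of t^(-c), so t cancels; th > 1 makes c positive and the integral convergent at 0. *)
Lemma weak_smallness (R : realType) (p th K : R) : 1 < th < p -> 0 <= K ->
  K `^ ((p - 1) / th) * 2 `^ p <= (th - 1) / (p - 1) ->
  forall t, 0 < t -> ((2 `^ p * (K * t `^ (- (th / (p - 1)))) `^ (1 - th^-1))%:E *
     \int[@lebesgue_measure R]_(s in `]0%R, t[) ((K * s `^ (- (th / (p - 1)))) `^ (p / th - 1))%:E <= 1)%E.
Proof.
move=> /andP[th1 thp] K0 HK t t0.
have p1 : 0 < p - 1 by lra.
have th0 : 0 < th by lra.
pose c := (th - 1) / (p - 1).
have c0 : 0 < c by rewrite divr_gt0// subr_gt0.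
have -> : (\int[@lebesgue_measure R]_(s in `]0%R, t[) ((K * s `^ (- (th / (p - 1)))) `^ (p / th - 1))%:E =
   (K `^ (p / th - 1))%:E * \int[@lebesgue_measure R]_(s in `]0%R, t[) (s `^ (c - 1))%:E)%E.
  rewrite -ge0_integralZl_EFin ?powR_ge0//; last 2 first.
  - by move=> s _; rewrite lee_fin powR_ge0.
  - by apply/measurable_EFinP; apply: measurable_funTS; exact: measurable_powR.
  apply: eq_integral => s _; rewrite -EFinM powRM ?powR_ge0// -powRrM; congr (_ * _ `^ _)%:E.
  by rewrite /c; field; rewrite !gt_eqF.
rewrite muleA -EFinM.
apply: (@le_trans _ _ ((2 `^ p * (K * t `^ (- (th / (p - 1)))) `^ (1 - th^-1) * K `^ (p / th - 1))%:E * (t `^ c / c)%:E)%E).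
  apply: lee_wpmul2l; first by rewrite lee_fin !mulr_ge0 ?powR_ge0.
  exact: le_integral_powR_0.
rewrite -EFinM lee_fin powRM ?powR_ge0// -powRrM.
have -> : - (th / (p - 1)) * (1 - th^-1) = - c by rewrite /c; field; rewrite !gt_eqF.
rewrite [t `^ (- c)]powRN.
have e : K `^ (1 - th^-1) * K `^ (p / th - 1) = K `^ ((p - 1) / th).
  rewrite -powRD; first by congr (_ `^ _); ring.
  (* [K] may be 0, and then exponents add only if their sum is nonzero. *)
  apply/implyP => /eqP h; exfalso.
  have : (p - 1) / th = 0 by rewrite -h; ring.
  by move/eqP; rewrite gt_eqF// divr_gt0.
have tc : 0 < t `^ c by rewrite powR_gt0.
rewrite [leLHS](_ : _ = (K `^ (1 - th^-1) * K `^ (p / th - 1)) * 2 `^ p / c); last first.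
  by field; rewrite !gt_eqF.
by rewrite e ler_pdivrMr// mul1r.
Qed.

(** The case th = 1, where the power of the sup norm in front of the integral is 1. The bound [A]
    controls the integral up to a time [tau], and the decay controls the rest because sig > 1; the
    hypothesis makes each piece at most 1/(2 * 2^p). *)
Lemma strong_smallness (R : realType) (p sig A G : R) : 1 < p -> 1 < sig -> 0 <= A -> 0 <= G ->
  G `^ (p - 1) * A `^ ((p - 1) * (sig - 1)) <= (sig - 1) * 2 `^ (- ((p + 1) * sig)) ->
  forall t, 0 < t -> ((2 `^ p)%:E *
     \int[@lebesgue_measure R]_(s in `]0%R, t[)
        (Num.min A (G * s `^ (- (sig / (p - 1)))) `^ (p - 1))%:E <= 1)%E.
Proof.
move=> p1 sig1 A0 G0 HG t t0.
have q0 : 0 < p - 1 by rewrite subr_gt0.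
set f := fun s : R => Num.min A (G * s `^ (- (sig / (p - 1)))) `^ (p - 1).
have m0 s : 0 <= Num.min A (G * s `^ (- (sig / (p - 1)))).
  by rewrite le_min A0 mulr_ge0 ?powR_ge0.
have mf E : measurable_fun E (fun s => (f s)%:E).
  apply/measurable_EFinP; apply: measurable_funTS; apply: (measurableT_comp (measurable_powR _)).
  apply: measurable_minr => //; apply: measurable_funM => //; exact: measurable_powR.
have f0 s : (0 <= (f s)%:E)%E by rewrite lee_fin powR_ge0.
have fA s : f s <= A `^ (p - 1).
  by rewrite ge0_ler_powR ?nnegrE ?(ltW q0)// ge_min lexx.
have fG s : f s <= G `^ (p - 1) * s `^ ((1 - sig) - 1).
  apply: (@le_trans _ _ ((G * s `^ (- (sig / (p - 1)))) `^ (p - 1))).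
    by rewrite ge0_ler_powR ?nnegrE ?(ltW q0) ?mulr_ge0 ?powR_ge0// ge_min lexx orbT.
  rewrite powRM ?powR_ge0// -powRrM.
  have -> : - (sig / (p - 1)) * (p - 1) = 1 - sig - 1 by field; rewrite gt_eqF.
  by [].
have p2 : 0 < 2 `^ p :> R by rewrite powR_gt0.
(* For A = 0 the time [tau] below would not be positive; the integrand then vanishes. *)
have [A00|AN0] := eqVneq A 0.
  rewrite integral0_eq ?mule0// => s _; congr EFin.
  apply/eqP; rewrite eq_le powR_ge0 andbT; apply: (le_trans (fA s)).
  by rewrite A00 powR0// gt_eqF.
have Ap : 0 < A by rewrite lt_neqAle eq_sym AN0.
(* Chosen so that A^(p-1) tau = 1/(2 * 2^p), half of the allowed total. *)
pose tau := (2 * 2 `^ p * A `^ (p - 1))^-1.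
have tau0 : 0 < tau by rewrite invr_gt0 !mulr_gt0 ?powR_gt0.
have I1 : (\int[@lebesgue_measure R]_(s in `]0%R, tau]) (f s)%:E <= ((2 * 2 `^ p)^-1)%:E)%E.
  apply: (@le_trans _ _ (\int[@lebesgue_measure R]_(s in `]0%R, tau]) (A `^ (p - 1))%:E)%E).
    apply: ge0_le_integral.
    - exact: measurable_itv.
    - by move=> s _; exact: f0.
    - exact: mf.
    - exact: measurable_cst.
    - by move=> s _; rewrite lee_fin.
  rewrite integral_cst//= lebesgue_measure_itv/= lte_fin tau0 oppr0 adde0 -EFinM lee_fin.
  rewrite /tau invfM mulrCA mulfV ?mulr1// gt_eqF// powR_gt0//.
have I2 b : tau < b -> (\int[@lebesgue_measure R]_(s in `[tau, b]) (f s)%:E <= ((2 * 2 `^ p)^-1)%:E)%E.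
  move=> tb.
  apply: (@le_trans _ _ (\int[@lebesgue_measure R]_(s in `[tau, b]) ((G `^ (p - 1))%:E * (s `^ ((1 - sig) - 1))%:E))%E).
    apply: ge0_le_integral.
    - exact: measurable_itv.
    - by move=> s _; exact: f0.
    - exact: mf.
    - by apply: emeasurable_funM => //; apply/measurable_EFinP; apply: measurable_funTS; exact: measurable_powR.
    - by move=> s _; rewrite -EFinM lee_fin.
  rewrite ge0_integralZl_EFin ?powR_ge0//; last 2 first.
  - by move=> s _; rewrite lee_fin powR_ge0.
  - by apply/measurable_EFinP; apply: measurable_funTS; exact: measurable_powR.
  apply: (@le_trans _ _ ((G `^ (p - 1))%:E * (tau `^ (1 - sig) / - (1 - sig))%:E)%E).
    apply: lee_wpmul2l; first by rewrite lee_fin powR_ge0.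
    by apply: le_integral_powR_infty => //; rewrite subr_lt0.
  rewrite -EFinM lee_fin opprB mulrA ler_pdivrMr ?subr_gt0//.
  have -> : tau `^ (1 - sig) = 2 `^ ((p + 1) * (sig - 1)) * A `^ ((p - 1) * (sig - 1)).
    rewrite /tau; have -> : 2 * 2 `^ p = 2 `^ (p + 1) :> R.
      by rewrite powRD ?powRr1// ?(gt_eqF (ltr0n _ 2)) ?implybT// mulrC.
    rewrite -[_^-1]powR_inv1 ?mulr_ge0 ?powR_ge0// -powRrM.
    have -> : -1 * (1 - sig) = sig - 1 by ring.
    by rewrite powRM ?powR_ge0// -!powRrM.
  have -> : (2 * 2 `^ p)^-1 * (sig - 1) = 2 `^ ((p + 1) * (sig - 1)) * ((sig - 1) * 2 `^ (- ((p + 1) * sig))).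
    rewrite mulrCA -powRD ?(gt_eqF (ltr0n _ 2)) ?implybT//.
    have -> : (p + 1) * (sig - 1) + - ((p + 1) * sig) = - (p + 1) by ring.
    by rewrite powRN powRD ?powRr1 ?(gt_eqF (ltr0n _ 2)) ?implybT// mulrC [_ * 2]mulrC.
  by rewrite mulrCA ler_pM2l ?powR_gt0.
have half : (\int[@lebesgue_measure R]_(s in `]0%R, t[) (f s)%:E <= ((2 * 2 `^ p)^-1 + (2 * 2 `^ p)^-1)%:E)%E.
  (* An end point beyond both [t] and [tau], so that the split at [tau] needs no comparison of the
     two. *)
  pose b := t + tau.
  have tb : tau < b by rewrite /b ltrDr.
  apply: (@le_trans _ _ (\int[@lebesgue_measure R]_(s in `]0%R, tau] `|` `]tau, b]) (f s)%:E)%E).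
    apply: ge0_subset_integral.
    - exact: measurable_itv.
    - by apply: measurableU; exact: measurable_itv.
    - exact: mf.
    - by move=> s _; exact: f0.
    move=> s; rewrite /= !in_itv/= => /andP[s0 st]; have [h|h] := leP s tau; [left|right].
      by rewrite s0.
    by rewrite /b (le_trans (ltW st))// lerDl ltW.
  rewrite ge0_integral_setU; first last.
  - apply/disj_setPS => s [/=]; rewrite !in_itv/= => /andP[_ h1] /andP[h2 _].
    by have := lt_le_trans h2 h1; rewrite ltxx.
  - by move=> s _; exact: f0.
  - exact: mf.
  - exact: measurable_itv.
  - exact: measurable_itv.
  rewrite EFinD; apply: leeD => //.
  by rewrite integral_itv_obnd_cbnd//; exact: I2.
apply: (@le_trans _ _ ((2 `^ p)%:E * ((2 * 2 `^ p)^-1 + (2 * 2 `^ p)^-1)%:E)%E).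
  by apply: lee_wpmul2l => //; rewrite lee_fin ltW.
by rewrite -EFinM lee_fin le_eqVlt; apply/orP; left; apply/eqP; field; rewrite gt_eqF.
Qed.

(** Since 1 + t <= 2 max(1, t), the factor 2^g turns the bound [a], used for t <= 1, and the bound
    by t^(-g), used for t > 1, into a power of 1 + t. *)
Lemma decay_interpolate (R : realType) (g a b t m : R) : 0 <= g -> 0 <= a -> 0 <= b -> 0 < t ->
  m <= a -> m <= b * t `^ (- g) -> m <= (a + b) * 2 `^ g * (1 + t) `^ (- g).
Proof.
move=> g0 a0 b0 t0 ma mb.
have h2 c : 0 < c -> 1 + t <= 2 * c -> c `^ (- g) <= 2 `^ g * (1 + t) `^ (- g).
  move=> c0 hc; rewrite !powRN -[leLHS]mul1r ler_pdivrMr ?powR_gt0// mulrAC.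
  rewrite ler_pdivlMr ?powR_gt0//; last by lra.
  by rewrite mul1r -powRM ?(ltW c0)// ge0_ler_powR ?nnegrE; lra.
have [t1|t1] := leP t 1.
  have := h2 1 ltr01; rewrite powR1 => /(_ _) h.
  apply: (le_trans ma); rewrite -mulrA; apply: (@le_trans _ _ (a * 1)); first by rewrite mulr1.
  apply: ler_pM => //; [by lra|apply: h; lra].
apply: (le_trans mb); rewrite -mulrA; apply: ler_pM; rewrite ?powR_ge0//; first by lra.
by apply: h2 => //; lra.
Qed.

(** Interpolating an L^r bound without decay with a sup bound of rate kap/r gives in L^q the rate
    (kap/r)(1 - r/q) = kap (1/r - 1/q), hence the exact cancellation. *)
Lemma decay_exponent (R : realType) (kap C r q t : R) : 0 < t -> 0 <= C -> 0 < r -> 0 < q ->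
  (1 + t) `^ (kap * (r^-1 - q^-1)) * (C * (1 + t) `^ (- (kap / r))) `^ (1 - r / q) = C `^ (1 - r / q).
Proof.
move=> t0 C0 r0 q0; have t1 : 0 < 1 + t by lra.
rewrite powRM ?powR_ge0// -powRrM mulrCA -powRD ?(gt_eqF t1) ?implybT//.
have -> : kap * (r^-1 - q^-1) + - (kap / r) * (1 - r / q) = 0 by field; rewrite !gt_eqF.
by rewrite powRr0 mulr1.
Qed.

(** * Semigroups of nonnegative kernels *)

Section heat.
Context {d : measure_display} {T : measurableType d} {R : realType}.
Variable mu : {sigma_finite_measure set T -> \bar R}.
Variable k : T -> T -> R -> R.
Hypothesis mk : measurable_fun [set: (T * T) * R] (fun z => k z.1.1 z.1.2 z.2).
Hypothesis k_ge0 : forall x y t, 0 <= k x y t.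
Hypothesis k_neg : forall x y t, t <= 0 -> k x y t = 0.
Hypothesis k_mass : forall x t, 0 < t -> (\int[mu]_y (k x y t)%:E = 1)%E.
Hypothesis k_semi : forall x y t s, 0 < t -> 0 < s ->
  ((k x y (t + s))%:E = \int[mu]_z (k x z t * k z y s)%:E)%E.

(** [k x y t] stands for the heat kernel times the weight at [y], so no weight appears.
    Extended-real sources let the operator act on its own output before that is known to be
    finite. *)
Definition heat (t : R) (f : T -> \bar R) (x : T) : \bar R :=
  (\int[mu]_y ((k x y t)%:E * f y))%E.

Lemma measurable_kernel d' (S : measurableType d') (f g : S -> T) (h : S -> R) :
  measurable_fun setT f -> measurable_fun setT g -> measurable_fun setT h ->
  measurable_fun setT (fun z => k (f z) (g z) (h z)).
Proof.
move=> mf mg mh.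
pose H z := ((f z, g z), h z).
have mH : measurable_fun setT H by apply: measurable_fun_pair => //; exact: measurable_fun_pair.
exact: (measurableT_comp mk mH).
Qed.

Lemma measurable_kernel_r x t : measurable_fun setT (fun y => k x y t).
Proof. exact: measurable_kernel. Qed.

(** Source, point and time may all depend on a parameter; Tonelli then covers at once the flow of
    the data in (x, t) and the Duhamel integrand. *)
Lemma measurable_heat d' (S : measurableType d') (f : S -> T -> \bar R) (g : S -> T) (h : S -> R) :
  measurable_fun setT (fun z : S * T => f z.1 z.2) -> (forall s y, 0 <= f s y)%E ->
  measurable_fun setT g -> measurable_fun setT h ->
  measurable_fun setT (fun z => heat (h z) (f z) (g z)).
Proof.
move=> mf f0 mg mh.
pose F (z : S * T) : \bar R := ((k (g z.1) z.2 (h z.1))%:E * f z.1 z.2)%E.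
apply: (@measurable_fun_fubini_tonelli_F _ _ S T R mu F); last first.
  by move=> z; rewrite mule_ge0// lee_fin.
apply: emeasurable_funM => //; apply/measurable_EFinP.
by apply: measurable_kernel => //; apply: measurableT_comp.
Qed.

Lemma measurable_heat_slice t (f : T -> \bar R) :
  measurable_fun setT f -> (forall y, 0 <= f y)%E -> measurable_fun setT (heat t f).
Proof.
move=> mf f0; apply: (measurable_heat (f := fun _ => f) (g := id) (h := fun=> t)) => //.
exact: (measurableT_comp mf).
Qed.

Lemma heat_ge0 t f x : (forall y, 0 <= f y)%E -> (0 <= heat t f x)%E.
Proof. by move=> f0; apply: integral_ge0 => y _; rewrite mule_ge0// lee_fin. Qed.

Lemma measurable_heat_integrand t x (f : T -> \bar R) : measurable_fun setT f ->
  measurable_fun setT (fun y => (k x y t)%:E * f y)%E.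
Proof.
move=> mf; apply: emeasurable_funM => //; apply/measurable_EFinP.
exact: measurable_kernel_r.
Qed.

Lemma ae_le_heat t (f g : T -> \bar R) x : measurable_fun setT f -> measurable_fun setT g ->
  (forall y, 0 <= f y)%E -> (forall y, 0 <= g y)%E ->
  (\forall y \ae mu, (f y <= g y)%E) -> (heat t f x <= heat t g x)%E.
Proof.
move=> mf mg f0 g0 fg; apply: ae_ge0_le_integral => //.
- by move=> y _; rewrite mule_ge0// lee_fin.
- exact: measurable_heat_integrand.
- by move=> y _; rewrite mule_ge0// lee_fin.
- exact: measurable_heat_integrand.
- by apply: filterS fg => y fgy _; rewrite lee_pmul ?lee_fin.
Qed.

Lemma le_heat t (f g : T -> \bar R) x : measurable_fun setT f -> measurable_fun setT g ->
  (forall y, 0 <= f y)%E -> (forall y, f y <= g y)%E -> (heat t f x <= heat t g x)%E.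
Proof.
move=> mf mg f0 fg; apply: ae_le_heat => //; first by move=> y; exact: le_trans (fg y).
exact: nearW.
Qed.

Lemma heat_cst t c x : 0 < t -> (0 <= c)%E -> heat t (cst c) x = c.
Proof.
move=> t0 c0; rewrite /heat ge0_integralZr ?k_mass ?mul1e//.
- by apply/measurable_EFinP; exact: measurable_kernel_r.
- by move=> y _; rewrite lee_fin.
Qed.

Lemma heat_le_cst t (f : T -> \bar R) x c : 0 < t -> (0 <= c)%E -> measurable_fun setT f ->
  (forall y, 0 <= f y)%E -> (\forall y \ae mu, (f y <= c)%E) -> (heat t f x <= c)%E.
Proof.
move=> t0 c0 mf f0 fc; rewrite -[X in (_ <= X)%E](heat_cst x t0)//.
by apply: ae_le_heat => //; exact: measurable_cst.
Qed.

Lemma heatZ t (f : T -> \bar R) x c : (0 <= c)%E -> measurable_fun setT f -> (forall y, 0 <= f y)%E ->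
  heat t (fun y => c * f y)%E x = (c * heat t f x)%E.
Proof.
move=> c0 mf f0; rewrite /heat -ge0_integralZl//.
- by apply: eq_integral => y _; rewrite muleCA.
- exact: measurable_heat_integrand.
- by move=> y _; rewrite mule_ge0// lee_fin.
Qed.

Lemma heatD t (f g : T -> \bar R) x : measurable_fun setT f -> measurable_fun setT g ->
  (forall y, 0 <= f y)%E -> (forall y, 0 <= g y)%E ->
  heat t (fun y => f y + g y)%E x = (heat t f x + heat t g x)%E.
Proof.
move=> mf mg f0 g0; rewrite /heat -ge0_integralD//.
- by apply: eq_integral => y _; rewrite ge0_muleDr.
- by move=> y _; rewrite mule_ge0// lee_fin.
- exact: measurable_heat_integrand.
- by move=> y _; rewrite mule_ge0// lee_fin.
- exact: measurable_heat_integrand.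
Qed.

Lemma heat_heat t s (f : T -> \bar R) x : 0 < t -> 0 < s -> measurable_fun setT f -> (forall y, 0 <= f y)%E ->
  heat t (heat s f) x = heat (t + s) f x.
Proof.
move=> t0 s0 mf f0; rewrite /heat.
pose F (z : T * T) : \bar R := ((k x z.1 t)%:E * ((k z.1 z.2 s)%:E * f z.2))%E.
have mF : measurable_fun setT F.
  apply: emeasurable_funM.
    by apply/measurable_EFinP; apply: measurable_kernel.
  apply: emeasurable_funM; last exact: measurableT_comp.
  by apply/measurable_EFinP; apply: measurable_kernel.
have F0 z : (0 <= F z)%E by rewrite !mule_ge0// lee_fin.
transitivity (\int[mu]_y \int[mu]_z F (y, z))%E.
  apply: eq_integral => y _; rewrite -ge0_integralZl ?lee_fin//.
  - exact: measurable_heat_integrand.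
  - by move=> z _; rewrite mule_ge0// lee_fin.
rewrite fubini_tonelli//; apply: eq_integral => z _.
rewrite k_semi// -ge0_integralZr//.
- by apply: eq_integral => y _; rewrite /F/= muleA EFinM.
- apply/measurable_EFinP; apply: measurable_funM.
    exact: measurable_kernel_r.
  exact: measurable_kernel.
- by move=> y _; rewrite lee_fin mulr_ge0.
Qed.

(** * The Duhamel term: monotone iteration, uniqueness, supersolutions *)

Variable p : R.

(** The value 0 at t <= 0 makes joint measurability a property on the whole product space, stable
    under the iteration. *)
Definition admissible (u : T -> R -> R) :=
  [/\ measurable_fun [set: T * R] (fun z => u z.1 z.2), forall x t, 0 <= u x t &
      forall x t, t <= 0 -> u x t = 0].

(* Integrating over all s in R is harmless: for admissible u the integrand
   vanishes unless 0 < s < t. *)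
Definition duhamel (u : T -> R -> R) (x : T) (t : R) : \bar R :=
  (\int[@lebesgue_measure R]_s heat (t - s) (fun y => (u y s `^ p)%:E) x)%E.

Lemma measurable_powR_section (u : T -> R -> R) s q : admissible u ->
  measurable_fun setT (fun y => (u y s `^ q)%:E).
Proof.
move=> [mu_ _ _]; apply/measurable_EFinP; apply: (measurableT_comp (measurable_powR q)).
have mp : measurable_fun setT (fun y : T => (y, s)) by exact: measurable_fun_pair.
exact: (measurableT_comp mu_ mp).
Qed.

Lemma measurable_duhamel_integrand (u : T -> R -> R) d' (S : measurableType d') (f : S -> T) (g h : S -> R) :
  admissible u -> measurable_fun setT f -> measurable_fun setT g -> measurable_fun setT h ->
  measurable_fun setT (fun z => heat (g z - h z) (fun y => (u y (h z) `^ p)%:E) (f z)).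
Proof.
move=> [mu_ _ _] mf mg mh; apply: measurable_heat => //.
- apply/measurable_EFinP; apply: (measurableT_comp (measurable_powR p)).
  have mp : measurable_fun setT (fun z : S * T => (z.2, h z.1)).
    by apply: measurable_fun_pair => //; exact: measurableT_comp.
  exact: (measurableT_comp mu_ mp).
- by move=> s y; rewrite lee_fin powR_ge0.
- exact: measurable_funB.
Qed.

Lemma measurable_duhamel (u : T -> R -> R) : admissible u ->
  measurable_fun setT (fun z : T * R => duhamel u z.1 z.2).
Proof.
move=> au.
pose F (z : (T * R) * R) : \bar R := heat (z.1.2 - z.2) (fun y => (u y z.2 `^ p)%:E) z.1.1.
have mF : measurable_fun setT F.
  by apply: measurable_duhamel_integrand => //; apply: measurableT_comp.
have F0 z : (0 <= F z)%E by apply: heat_ge0 => y; rewrite lee_fin powR_ge0.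
have := @measurable_fun_fubini_tonelli_F _ _ _ _ _ (@lebesgue_measure R) F mF F0.
apply: eq_measurable_fun => z _; reflexivity.
Qed.

Lemma duhamel_ge0 u x t : (0 <= duhamel u x t)%E.
Proof. by apply: integral_ge0 => s _; apply: heat_ge0 => y; rewrite lee_fin powR_ge0. Qed.

Lemma le_duhamel u v x t : 0 <= p -> admissible u -> admissible v ->
  (forall y s, u y s <= v y s) -> (duhamel u x t <= duhamel v x t)%E.
Proof.
move=> p0 au av uv; have [_ u0 _] := au; have [_ v0 _] := av.
apply: ge0_le_integral.
- exact: measurableT.
- by move=> s _; apply: heat_ge0 => y; rewrite lee_fin powR_ge0.
- exact: (@measurable_duhamel_integrand u _ _ (fun=> x) (fun=> t) id).
- exact: (@measurable_duhamel_integrand v _ _ (fun=> x) (fun=> t) id).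
- move=> s _; apply: le_heat.
  + exact: measurable_powR_section.
  + exact: measurable_powR_section.
  + by move=> y; rewrite lee_fin powR_ge0.
  + by move=> y; rewrite lee_fin ge0_ler_powR ?nnegrE.
Qed.

Lemma heat_neg t f x : t <= 0 -> heat t f x = 0%E.
Proof.
by move=> t0; apply: integral0_eq => y _; rewrite k_neg// mul0e.
Qed.

Hypothesis p_ge1 : 1 <= p.

Lemma powR0_p : 0 `^ p = 0 :> R.
Proof. by rewrite powR0// gt_eqF// (lt_le_trans _ p_ge1). Qed.

Lemma duhamel_neg u x t : admissible u -> t <= 0 -> duhamel u x t = 0%E.
Proof.
move=> [_ _ u0] t0; apply: integral0_eq => s _.
have [st|ts] := ltP s t; last by rewrite heat_neg// subr_le0.
apply: integral0_eq => y _; rewrite u0 ?powR0_p ?mule0//.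
by rewrite (le_trans (ltW st)).
Qed.

(** Monotone convergence twice: in space for fixed [s], then in time. *)
Lemma cvg_duhamel (v : (T -> R -> R)^nat) u x t :
  (forall n, admissible (v n)) -> (forall n x t, v n x t <= v n.+1 x t) ->
  (forall n x t, v n x t <= u x t) -> (forall x t, v n x t @[n --> \oo] --> u x t) ->
  duhamel (v n) x t @[n --> \oo] --> duhamel u x t.
Proof.
move=> av ndv vu cv.
have v0 n y s : 0 <= v n y s by have [_ ->] := av n.
have p0 : 0 <= p by rewrite (le_trans _ p_ge1).
have ndp y s : {homo (fun n => (v n y s `^ p)%:E) : n m / (n <= m)%N >-> (n <= m)%E}.
  apply/nondecreasing_seqP => n; rewrite lee_fin ge0_ler_powR ?nnegrE//.
apply: cvg_integral_nondecreasing.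
- by move=> n; exact: (@measurable_duhamel_integrand (v n) _ _ (fun=> x) (fun=> t) id).
- by move=> n s; apply: heat_ge0 => y; rewrite lee_fin powR_ge0.
- move=> s n m nm; apply: le_heat => [| | y|y].
  + exact: measurable_powR_section.
  + exact: measurable_powR_section.
  + by rewrite lee_fin powR_ge0.
  + exact: ndp.
- move=> s; apply: cvg_integral_nondecreasing.
  + by move=> n; apply: measurable_heat_integrand; exact: measurable_powR_section.
  + by move=> n y; rewrite mule_ge0// lee_fin ?powR_ge0.
  + by move=> y n m nm; rewrite lee_wpmul2l ?lee_fin//; have := ndp y s n m nm; rewrite lee_fin.
  + move=> y; apply: cvgeZl => //; apply: cvg_EFin; first exact: nearW.
    by apply: cvg_nondecreasing_powR => // n; rewrite v0 vu.
Qed.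

(** The map [S] is monotone and preserves the set of functions below [U], so its iterates from 0
    increase. As [U] is real-valued, the iterates and their limit are finite, and the equation holds
    at every point rather than almost everywhere. *)
Lemma supersolution_fixpoint (u0 : T -> R) (U : T -> R -> R) :
  measurable_fun setT u0 -> (forall x, 0 <= u0 x) -> admissible U ->
  (forall x t, 0 < t -> (heat t (EFin \o u0) x + duhamel U x t <= (U x t)%:E)%E) ->
  exists u, [/\ admissible u, forall x t, u x t <= U x t &
    forall x t, (u x t)%:E = (heat t (EFin \o u0) x + duhamel u x t)%E].
Proof.
move=> mu0 u00 aU0 HU.
have p0 : 0 <= p by rewrite (le_trans _ p_ge1).
pose S (u : T -> R -> R) x t := (heat t (EFin \o u0) x + duhamel u x t)%E.
have S0 u x t : (0 <= S u x t)%E.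
  by rewrite adde_ge0 ?duhamel_ge0// heat_ge0// => y; rewrite lee_fin.
have SU u x t : admissible u -> (forall x t, u x t <= U x t) -> (S u x t <= (U x t)%:E)%E.
  move=> au uU; have [t0|t0] := ltP 0 t; last first.
    by rewrite /S heat_neg// duhamel_neg// adde0 lee_fin; have [_ ->] := aU0.
  by apply: le_trans (HU x t t0); apply: leeD2l; apply: le_duhamel.
(* By [SU], [fine] loses nothing on functions below [U]. *)
pose Phi (u : T -> R -> R) x t := fine (S u x t).
have PhiE u x t : admissible u -> (forall x t, u x t <= U x t) -> (Phi u x t)%:E = S u x t.
  by move=> au uU; rewrite fineK// ge0_fin_numE// (le_lt_trans (SU _ _ _ au uU))// ltry.
have mS u : admissible u -> measurable_fun setT (fun z : T * R => S u z.1 z.2).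
  move=> au; apply: emeasurable_funD; last exact: measurable_duhamel.
  apply: (measurable_heat (f := fun _ => EFin \o u0) (g := fst) (h := snd)) => //.
  by apply/measurable_EFinP; exact: (measurableT_comp mu0).
have aPhi u : admissible u -> (forall x t, u x t <= U x t) ->
    admissible (Phi u) /\ (forall x t, Phi u x t <= U x t).
  move=> au uU; split; last by move=> x t; rewrite -lee_fin PhiE// SU.
  split.
  - by apply: (measurableT_comp _ (mS _ au)).
  - by move=> x t; rewrite fine_ge0.
  - by move=> x t t0; rewrite /Phi /S heat_neg// duhamel_neg// adde0.
pose v n := iter n Phi (fun _ _ => 0).
have av n : admissible (v n) /\ (forall x t, v n x t <= U x t).
  elim: n => [|n [IH1 IH2]]; last exact: aPhi.
  have [_ U00 _] := aU0; split; last by move=> x t; exact: U00.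
  by split => //; exact: measurable_cst.
have vE n x t : (v n.+1 x t)%:E = S (v n) x t.
  by have [h1 h2] := av n; exact: PhiE.
have v0 x t : v 0%N x t = 0 by [].
clearbody v.
have ndv n x t : v n x t <= v n.+1 x t.
  elim: n x t => [|n IH] x t; first by have [[_ h _] _] := av 1%N; rewrite v0; exact: h.
  rewrite -lee_fin (vE n.+1) (vE n); apply: leeD2l; apply: le_duhamel.
  - exact: p0.
  - exact: (proj1 (av n)).
  - exact: (proj1 (av n.+1)).
  - exact: IH.
have ndv' x t : {homo (fun n => v n x t) : n m / (n <= m)%N >-> n <= m}.
  exact/nondecreasing_seqP.
have cv x t : cvgn (fun n => v n x t).
  apply: nondecreasing_is_cvgn => //; exists (U x t) => _ [n _ <-].
  by have [_ ->] := av n.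
pose u x t := limn (fun n => v n x t).
have vu n x t : v n x t <= u x t by exact: nondecreasing_cvgn_le.
have uU x t : u x t <= U x t.
  by apply: limr_le => //; apply: nearW => n; have [_ ->] := av n.
have au : admissible u.
  split.
  - apply: (@measurable_fun_cvg _ _ _ _ (fun n (z : T * R) => v n z.1 z.2)).
      by move=> n; have [[]] := av n.
    by move=> z _; exact: cv.
  - by move=> x t; apply: le_trans (vu 0%N x t); rewrite v0.
  - move=> x t t0; apply/eqP; rewrite eq_le (le_trans _ (vu 0%N x t)) ?v0// andbT.
    by rewrite (le_trans (uU x t))//; have [_ _ ->] := aU0.
exists u; split => // x t.
have c1 : (v n.+1 x t)%:E @[n --> \oo] --> (u x t)%:E.
  apply: cvg_EFin; first exact: nearW.
  by rewrite (cvg_shiftS (fun n => v n x t)); exact: cv.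
have c2 : (v n.+1 x t)%:E @[n --> \oo] --> S u x t.
  have -> : (fun n => (v n.+1 x t)%:E) = (fun n => S (v n) x t).
    by apply/funext => n; exact: vE.
  apply: cvgeD; last 2 first.
  - exact: cvg_cst.
  - by apply: cvg_duhamel => // n; have [] := av n.
  rewrite ge0_adde_def// inE ?duhamel_ge0 ?heat_ge0// => y; by rewrite lee_fin.
exact: (cvg_unique _ c1 c2).
Qed.
Lemma duhamelE u x t : admissible u ->
  duhamel u x t = (\int[@lebesgue_measure R]_(s in `]0%R, t[) heat (t - s) (fun y => (u y s `^ p)%:E) x)%E.
Proof.
move=> [_ _ u0]; rewrite [RHS]integral_mkcond; apply: eq_integral => s _.
rewrite patchE; case: ifPn => //; rewrite notin_setE/= in_itv/= => /negP.
rewrite negb_and -!leNgt => /orP[s0|ts]; last by rewrite heat_neg// subr_le0.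
by apply: integral0_eq => y _; rewrite u0// powR0_p mule0.
Qed.

Lemma measurable_duhamel_section (u : T -> R -> R) x t (D : set R) : admissible u ->
  measurable_fun D (fun s => heat (t - s) (fun y => (u y s `^ p)%:E) x).
Proof.
move=> au; apply: (@measurable_funS _ _ _ _ setT) => //.
exact: (@measurable_duhamel_integrand u _ _ (fun=> x) (fun=> t) id).
Qed.

(** Duhamel terms may be infinite, so their difference is never formed; the error is added to one
    side instead. *)
Lemma duhamel_le_add u v e x t : admissible u -> admissible v -> admissible e ->
  (forall y s, u y s `^ p <= v y s `^ p + e y s `^ p) ->
  (duhamel u x t <= duhamel v x t + duhamel e x t)%E.
Proof.
move=> au av ae uve; rewrite /duhamel -ge0_integralD; first last.
- exact: measurable_duhamel_section.
- by move=> s _; apply: heat_ge0 => y; rewrite lee_fin powR_ge0.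
- exact: measurable_duhamel_section.
- by move=> s _; apply: heat_ge0 => y; rewrite lee_fin powR_ge0.
- exact: measurableT.
apply: ge0_le_integral.
- exact: measurableT.
- by move=> s _; apply: heat_ge0 => y; rewrite lee_fin powR_ge0.
- exact: measurable_duhamel_section.
- by apply: emeasurable_funD; exact: measurable_duhamel_section.
- move=> s _; rewrite -heatD; first last.
  + by move=> y; rewrite lee_fin powR_ge0.
  + by move=> y; rewrite lee_fin powR_ge0.
  + exact: measurable_powR_section.
  + exact: measurable_powR_section.
  apply: le_heat.
  + exact: measurable_powR_section.
  + by apply: emeasurable_funD; exact: measurable_powR_section.
  + by move=> y; rewrite lee_fin powR_ge0.
  + by move=> y; rewrite -EFinD lee_fin.
Qed.

(** One turn of the Picard estimate: averaging in space keeps a bound that is constant in [y], and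
    integration in time raises the degree by one. *)
Lemma duhamel_le_monomial e x t c (j : nat) : admissible e -> 0 <= c -> 0 < t ->
  (\forall s \ae @lebesgue_measure R, 0 < s -> \forall y \ae mu, e y s `^ p <= c * s ^+ j) ->
  (duhamel e x t <= (c * t ^+ j.+1 / j.+1%:R)%:E)%E.
Proof.
move=> ae c0 t0 ec; rewrite duhamelE//.
have mc : measurable_fun `]0%R, t[ (fun s : R => (c * s ^+ j)%:E).
  apply/measurable_EFinP; apply: measurable_funTS; apply: measurable_funM => //.
apply: (@le_trans _ _ (\int[@lebesgue_measure R]_(s in `]0%R, t[) (c * s ^+ j)%:E)%E).
  apply: ae_ge0_le_integral.
  - exact: measurable_itv.
  - by move=> s _; apply: heat_ge0 => y; rewrite lee_fin powR_ge0.
  - exact: measurable_duhamel_section.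
  - by move=> s; rewrite /= in_itv/= => /andP[s0 _]; rewrite lee_fin mulr_ge0// exprn_ge0// ltW.
  - exact mc.
  - move: ec; apply: (@filterS _ _ (ae_filter_ringOfSetsType _)) => s ec; rewrite /= in_itv/= => /andP[s0 st].
    apply: heat_le_cst.
    + by rewrite subr_gt0.
    + by rewrite lee_fin mulr_ge0// exprn_ge0// ltW.
    + exact: measurable_powR_section.
    + by move=> y; rewrite lee_fin powR_ge0.
    + exact: ec.
have -> : (\int[@lebesgue_measure R]_(s in `]0%R, t[) (c * s ^+ j)%:E =
    c%:E * \int[@lebesgue_measure R]_(s in `]0%R, t[) (s `^ (j.+1%:R - 1))%:E)%E.
  rewrite -ge0_integralZl_EFin//.
  - apply: eq_integral => s; rewrite inE/= in_itv/= => /andP[s0 _].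
    by rewrite -natr1 addrK powR_mulrn ?(ltW s0)// EFinM.
  - by move=> s _; rewrite lee_fin powR_ge0.
  - by apply/measurable_EFinP; apply: measurable_funTS; exact: measurable_powR.
rewrite -mulrA EFinM; apply: lee_wpmul2l; first by rewrite lee_fin.
have := @le_integral_powR_0 R t j.+1%:R t0 (ltr0Sn _ _).
by rewrite powR_mulrn// ltW.
Qed.

(** The rate of the iteration is L = p M^(p-1), the Lipschitz constant of z^p on [0, M]. A bound
    valid for almost every time becomes valid for every positive time after one use of the equation.
    The flow of the data enters only as the common term [a]. *)
Lemma duhamel_unique (a : T -> R -> \bar R) (u v : T -> R -> R) M :
  admissible u -> admissible v -> 0 <= M ->
  (\forall s \ae @lebesgue_measure R, 0 < s -> \forall y \ae mu, u y s <= M) ->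
  (\forall s \ae @lebesgue_measure R, 0 < s -> \forall y \ae mu, v y s <= M) ->
  (forall t, 0 < t -> \forall x \ae mu, (u x t)%:E = (a x t + duhamel u x t)%E) ->
  (forall t, 0 < t -> \forall x \ae mu, (v x t)%:E = (a x t + duhamel v x t)%E) ->
  forall t, 0 < t -> \forall x \ae mu, u x t = v x t.
Proof.
move=> au av M0 uM vM uE vE.
have [mu_ u0 un] := au; have [mv_ v0 vn] := av.
have p0 : 0 < p by rewrite (lt_le_trans _ p_ge1).
(* e^p = |u^p - v^p|, so that the error term is again a Duhamel integral *)
pose e x t := `|u x t `^ p - v x t `^ p| `^ p^-1.
have eE x t : e x t `^ p = `|u x t `^ p - v x t `^ p|.
  by rewrite /e -powRrM mulVf ?gt_eqF// powRr1.
have ae : admissible e.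
  split.
  - apply: (measurableT_comp (measurable_powR _)); apply: measurableT_comp => //.
    apply: measurable_funB; exact: (measurableT_comp (measurable_powR _)).
  - by move=> x t; exact: powR_ge0.
  - by move=> x t t0; rewrite /e un// vn// subrr normr0 powR0// invr_eq0 gt_eqF.
pose L := p * M `^ (p - 1).
have L0 : 0 <= L by rewrite mulr_ge0 ?powR_ge0// ltW.
(* For j = 0 this is [M], which bounds the difference because both functions lie in [0, M] almost
   everywhere. *)
pose c j := M * L ^+ j / j`!%:R.
have c0 j : 0 <= c j by rewrite !mulr_ge0 ?invr_ge0// exprn_ge0.
have step j : (\forall s \ae @lebesgue_measure R, 0 < s -> \forall y \ae mu, `|u y s - v y s| <= c j * s ^+ j) ->
    forall t, 0 < t -> \forall x \ae mu, `|u x t - v x t| <= c j.+1 * t ^+ j.+1.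
  move=> H t t0.
  have De x : (duhamel e x t <= (c j.+1 * t ^+ j.+1)%:E)%E.
    have -> : c j.+1 * t ^+ j.+1 = (L * c j) * t ^+ j.+1 / j.+1%:R.
      rewrite /c factS natrM exprS; field.
      by rewrite nat1r !pnatr_eq0/= -lt0n fact_gt0.
    apply: duhamel_le_monomial => //; first by rewrite mulr_ge0.
    move: H uM vM; apply: (@filterS3 _ _ (ae_filter_ringOfSetsType _)) => s H uM vM s0.
    move: (H s0) (uM s0) (vM s0); apply: filterS3 => y Hy uy vy.
    rewrite eE (le_trans (@powR_lipschitz R p M _ _ p_ge1 _ _)) ?u0 ?v0//.
    by rewrite -[leRHS]mulrA; apply: ler_wpM2l.
  move: (uE t t0) (vE t t0); apply: filterS2 => x ux vx.
  rewrite ler_norml lerBlDl -!lee_fin; apply/andP; split.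
  - rewrite lee_fin lerBrDl lerBlDr -lee_fin EFinD ux vx -addeA.
    apply: leeD2l; apply: le_trans (leeD2l _ (De x)).
    apply: duhamel_le_add => // y s; rewrite eE -lerBlDl distrC.
    exact: ler_norm.
  - rewrite EFinD ux vx -addeA.
    apply: leeD2l; apply: le_trans (leeD2l _ (De x)).
    apply: duhamel_le_add => // y s; rewrite eE -lerBlDl.
    exact: ler_norm.
have Hj j : \forall s \ae @lebesgue_measure R, 0 < s -> \forall y \ae mu, `|u y s - v y s| <= c j * s ^+ j.
  elim: j => [|j IH]; last by apply: nearW => s; exact: step.
  move: uM vM; apply: (@filterS2 _ _ (ae_filter_ringOfSetsType _)) => s uM vM s0.
  move: (uM s0) (vM s0); apply: filterS2 => y uy vy.
  rewrite /c !expr0 fact0 invr1 !mulr1.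
  by rewrite ler_norml; move: (u0 y s) (v0 y s) uy vy; lra.
move=> t t0.
(* The countably many null sets, one for each [j], are discarded together. *)
have /ae_foralln : forall j, \forall x \ae mu, `|u x t - v x t| <= c j.+1 * t ^+ j.+1.
  by move=> j; exact: step.
apply: filterS => x H; apply/eqP; rewrite -subr_eq0 -normr_le0.
have cv : (c j.+1 * t ^+ j.+1) @[j --> \oo] --> 0.
  have -> : (fun j => c j.+1 * t ^+ j.+1) = (fun j => M * exp_coeff (L * t) j.+1).
    have key (l f : R) j : M * l ^+ j / f * t ^+ j = M * (f^-1 * (l * t) ^+ j).
      by rewrite exprMn; ring.
    by apply/funext => j; rewrite /c exp_coeffE key.
  rewrite -[X in _ --> X](mulr0 M); apply: cvgM; first exact: cvg_cst.
  rewrite (cvg_shiftS (exp_coeff (L * t))).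
  exact: (cvg_series_cvg_0 (is_cvg_series_exp_coeff _)).
by apply: (ler_cvg_to (cvg_cst _) cv); exact: nearW.
Qed.

(* Integrate the tangent-line inequality at c, then let c decrease to b^(1/m). *)
Lemma heat_jensen m (f : T -> R) t x b : 1 <= m -> 0 < t -> measurable_fun setT f ->
  (forall y, 0 <= f y) -> 0 <= b ->
  (heat t (fun y => (f y `^ m)%:E) x <= b%:E)%E -> (heat t (EFin \o f) x <= (b `^ m^-1)%:E)%E.
Proof.
move=> m1 t0 mf f0 b0 fb.
have m0 : 0 < m by rewrite (lt_le_trans _ m1).
have mfE : measurable_fun setT (EFin \o f) by exact/measurable_EFinP.
have mfm : measurable_fun setT (fun y => (f y `^ m)%:E).
  by apply/measurable_EFinP; exact: (measurableT_comp (measurable_powR m)).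
apply/lee_addgt0Pr => eps eps0; rewrite -EFinD.
set c := b `^ m^-1 + eps.
have c0 : 0 < c by rewrite ltr_wpDl ?powR_ge0.
have bc : b <= c `^ m.
  rewrite -[X in X <= _]powRr1// -(mulVf (lt0r_neq0 m0)) powRrM.
  by rewrite ge0_ler_powR ?nnegrE ?powR_ge0 ?(ltW m0) ?(ltW c0)// /c lerDl ltW.
have h : ((m * c `^ (m - 1))%:E * heat t (EFin \o f) x <= (m * c `^ m)%:E)%E.
  rewrite -heatZ//; last first.
    by rewrite lee_fin mulr_ge0 ?powR_ge0// ltW.
  apply: (@le_trans _ _ (heat t (fun y => (f y `^ m)%:E + ((m - 1) * c `^ m)%:E)%E x)).
    apply: le_heat.
    - by apply: emeasurable_funM.
    - by apply: emeasurable_funD.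
    - by move=> y; rewrite mule_ge0// lee_fin// mulr_ge0 ?powR_ge0// ltW.
    - move=> y /=; rewrite -EFinM -EFinD lee_fin.
      have := powR_tangent m1 (f0 y) c0.
      have -> : c `^ m = c `^ (m - 1) * c.
        by rewrite -[X in _ = _ * X]powRr1 ?(ltW c0)// -powRD ?subrK ?(gt_eqF c0) ?implybT.
      lra.
  rewrite heatD//; last 2 first.
  - by move=> y; rewrite lee_fin powR_ge0.
  - by move=> y; rewrite lee_fin mulr_ge0 ?subr_ge0 ?powR_ge0.
  rewrite (heat_cst (c := ((m - 1) * c `^ m)%:E))//; last first.
    by rewrite lee_fin mulr_ge0 ?subr_ge0 ?powR_ge0.
  apply: (@le_trans _ _ (b%:E + ((m - 1) * c `^ m)%:E)%E); first exact: leeD2r.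
  by rewrite -EFinD lee_fin; lra.
have K0 : 0 < m * c `^ (m - 1) by rewrite mulr_gt0 ?powR_gt0.
rewrite -(@lee_pmul2l _ (m * c `^ (m - 1))%:E) ?lte_fin//.
apply: (le_trans h); rewrite -EFinM lee_fin -mulrA ler_pM2l//.
by rewrite -[X in _ * X]powRr1 ?(ltW c0)// -powRD ?subrK ?(gt_eqF c0) ?implybT.
Qed.

(** [B] is a measurable majorant of the sup norms in the smallness condition, so that explicit
    functions of time can replace the suprema. *)
Lemma supersolution th (B : R -> R) (u0 : T -> R) : 1 <= th <= p ->
  measurable_fun setT u0 -> (forall x, 0 <= u0 x) ->
  measurable_fun setT B -> (forall t, 0 <= B t) ->
  (forall x t, 0 < t -> (heat t (fun y => (u0 y `^ th)%:E) x <= (B t)%:E)%E) ->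
  (forall t, 0 < t -> ((2 `^ p * B t `^ (1 - th^-1))%:E *
     \int[@lebesgue_measure R]_(s in `]0%R, t[) (B s `^ (p / th - 1))%:E <= 1)%E) ->
  let U x t := 2 * fine (heat t (fun y => (u0 y `^ th)%:E) x) `^ th^-1 in
  admissible U /\ (forall x t, 0 < t -> (heat t (EFin \o u0) x + duhamel U x t <= (U x t)%:E)%E).
Proof.
move=> /andP[th1 thp] mu0 u00 mB B0 HB HI U.
have th0 : 0 < th by rewrite (lt_le_trans _ th1).
have p0 : 0 < p by rewrite (lt_le_trans _ p_ge1).
set f := (fun y => (u0 y `^ th)%:E).
have mf : measurable_fun setT f.
  by apply/measurable_EFinP; exact: (measurableT_comp (measurable_powR _)).
have f0 y : (0 <= f y)%E by rewrite lee_fin powR_ge0.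
have h0 t x : (0 <= heat t f x)%E by exact: heat_ge0.
pose V x t := fine (heat t f x).
have V0 x t : 0 <= V x t by rewrite fine_ge0.
have VE x t : 0 < t -> (V x t)%:E = heat t f x.
  by move=> t0; rewrite fineK// ge0_fin_numE// (le_lt_trans (HB x t t0))// ltry.
have VB x t : 0 < t -> V x t <= B t by move=> t0; rewrite -lee_fin VE// HB.
have mV : measurable_fun setT (fun z : T * R => V z.1 z.2).
  apply: (measurableT_comp (@fine_measurable _ setT measurableT)).
  apply: (measurable_heat (f := fun _ => f) (g := fst) (h := snd)) => //.
  exact: (measurableT_comp mf).
have UE x t : U x t = 2 * V x t `^ th^-1 by [].
clearbody U.
have aU : admissible U.
  split.
  - rewrite (_ : (fun z => _) = (fun z : T * R => 2 * V z.1 z.2 `^ th^-1)); last first.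
      by apply/funext => z; rewrite UE.
    apply: measurable_funM => //; exact: (measurableT_comp (measurable_powR _)).
  - by move=> x t; rewrite UE mulr_ge0 ?powR_ge0.
  - move=> x t t0; rewrite UE /V heat_neg// powR0 ?mulr0// invr_eq0 gt_eqF//.
split => // x t t0.
(* One half of [U] absorbs the flow of the data by Jensen, the other half the Duhamel term. *)
rewrite UE mulr_natl mulr2n EFinD; apply: leeD.
  by apply: (heat_jensen th1 t0 mu0 u00 (V0 x t)); rewrite VE.
rewrite duhamelE//.
set I := (\int[_]_(s in _) _)%E in HI *.
have mBp : measurable_fun `]0%R, t[ (fun s : R => (B s `^ (p / th - 1))%:E).
  by apply/measurable_EFinP; apply: measurable_funTS; exact: (measurableT_comp (measurable_powR _)).
have c0 : 0 <= 2 `^ p * V x t by rewrite mulr_ge0 ?powR_ge0.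
apply: (@le_trans _ _ (\int[@lebesgue_measure R]_(s in `]0%R, t[) ((2 `^ p * V x t)%:E * (B s `^ (p / th - 1))%:E))%E).
  apply: ge0_le_integral.
  - exact: measurable_itv.
  - by move=> s _; apply: heat_ge0 => y; rewrite lee_fin powR_ge0.
  - exact: measurable_duhamel_section.
  - apply: emeasurable_funM => //; exact: measurable_cst.
  - move=> s; rewrite /= in_itv/= => /andP[s0 st].
    have ts : 0 < t - s by rewrite subr_gt0.
    have mVs : measurable_fun setT (heat s f) by exact: measurable_heat_slice.
    apply: (@le_trans _ _ (heat (t - s) (fun y => (2 `^ p * B s `^ (p / th - 1))%:E * heat s f y)%E x)).
      apply: le_heat.
      + exact: measurable_powR_section.
      + by apply: emeasurable_funM.
      + by move=> y; rewrite lee_fin powR_ge0.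
      + move=> y; rewrite -VE// -EFinM lee_fin UE powRM ?powR_ge0// -mulrA ler_pM2l ?powR_gt0//.
        rewrite -powRrM [th^-1 * p]mulrC.
        (* One factor V is kept for the semigroup law; the rest, with exponent p/th - 1 >= 0 because
           th <= p, is replaced by its bound in [B s]. *)
        have -> : V y s `^ (p / th) = V y s `^ (p / th - 1) * V y s.
          rewrite -[X in _ = _ * X]powRr1// -powRD ?subrK//.
          by rewrite gt_eqF// divr_gt0.
        rewrite ler_wpM2r// ge0_ler_powR ?nnegrE// ?VB//.
        by rewrite subr_ge0 ler_pdivlMr ?mul1r.
    rewrite heatZ//; last by rewrite lee_fin mulr_ge0 ?powR_ge0.
    (* Flowing up to time s and then for t - s gives a result independent of s, so [V x t] leaves
       the time integral. *)
    by rewrite heat_heat// subrK -VE// -!EFinM lee_fin mulrAC.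
rewrite ge0_integralZl_EFin//; last by move=> s _; rewrite lee_fin powR_ge0.
(* V^(1/th) is the half of [U] to be matched; V^(1 - 1/th) becomes the prefactor of the smallness
   condition. *)
have VV : V x t = V x t `^ (1 - th^-1) * V x t `^ th^-1.
  by rewrite -powRD ?subrK ?powRr1// oner_eq0.
rewrite [in leLHS]VV mulrA [_ * V x t `^ th^-1]mulrC EFinM -muleA -[leRHS]mule1.
apply: lee_wpmul2l; first by rewrite lee_fin powR_ge0.
apply: le_trans (HI t t0); rewrite -/I; apply: lee_wpmul2r.
  by apply: integral_ge0 => s _; rewrite lee_fin powR_ge0.
rewrite lee_fin ler_wpM2l ?powR_ge0// ge0_ler_powR ?nnegrE ?VB//.
by rewrite subr_ge0 invf_le1.
Qed.

(** * Smoothing and contraction of the semigroup in strong and weak norms *)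

Variables (w : T -> R) (D kap : R).
Hypothesis mw : measurable_fun setT w.
Hypothesis w_ge0 : forall x, 0 <= w x.
Hypothesis D_gt0 : 0 < D.
Hypothesis k_adjoint : forall y t, 0 < t -> (\int[mu]_x (k x y t * w x)%:E = (w y)%:E)%E.
Hypothesis k_sup : forall x y t, 0 < t -> k x y t <= D * t `^ (- kap) * w y.

Lemma heat_sup t (f : T -> \bar R) x : 0 < t -> measurable_fun setT f -> (forall y, 0 <= f y)%E ->
  (heat t f x <= (D * t `^ (- kap))%:E * \int[mu]_y (f y * (w y)%:E))%E.
Proof.
move=> t0 mf f0.
have mwE : measurable_fun setT (EFin \o w) by exact/measurable_EFinP.
rewrite -ge0_integralZl_EFin//; last 3 first.
- by move=> y _; rewrite mule_ge0// lee_fin.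
- exact: emeasurable_funM.
- by rewrite mulr_ge0 ?powR_ge0// ltW.
apply: ge0_le_integral.
- exact: measurableT.
- by move=> y _; rewrite mule_ge0// lee_fin.
- exact: measurable_heat_integrand.
- by apply: emeasurable_funM => //; exact: emeasurable_funM.
- move=> y _; rewrite [X in (_ <= _ * X)%E]muleC muleA -EFinM.
  by apply: lee_wpmul2r => //; rewrite lee_fin k_sup.
Qed.

Lemma heat_mass t (f : T -> \bar R) : 0 < t -> measurable_fun setT f -> (forall y, 0 <= f y)%E ->
  (\int[mu]_x (heat t f x * (w x)%:E) = \int[mu]_y (f y * (w y)%:E))%E.
Proof.
move=> t0 mf f0.
have mwE : measurable_fun setT (EFin \o w) by exact/measurable_EFinP.
pose F (z : T * T) : \bar R := ((k z.1 z.2 t * w z.1)%:E * f z.2)%E.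
have mF : measurable_fun setT F.
  apply: emeasurable_funM; last exact: measurableT_comp.
  apply/measurable_EFinP; apply: measurable_funM; last exact: measurableT_comp.
  exact: measurable_kernel.
have F0 z : (0 <= F z)%E by rewrite mule_ge0// lee_fin mulr_ge0.
transitivity (\int[mu]_x \int[mu]_y F (x, y))%E.
  apply: eq_integral => x _; rewrite -ge0_integralZr ?lee_fin//.
  - by apply: eq_integral => y _; rewrite /F/= EFinM muleAC.
  - exact: measurable_heat_integrand.
  - by move=> y _; rewrite mule_ge0// lee_fin.
rewrite fubini_tonelli//; apply: eq_integral => y _.
rewrite -(k_adjoint y t0) muleC -ge0_integralZr//.
- apply/measurable_EFinP; apply: measurable_funM => //; exact: measurable_kernel.
- by move=> x _; rewrite lee_fin mulr_ge0.
Qed.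

(** Jensen with exponent r/th leaves the flow of f^r, to which the smoothing bound from weighted L^1
    applies. *)
Lemma heat_sup_Lr th r (f : T -> R) N t x : 0 < th -> th <= r -> 0 < t ->
  measurable_fun setT f -> (forall y, 0 <= f y) -> 0 <= N ->
  (\int[mu]_y (f y `^ r * w y)%:E <= N%:E)%E ->
  (heat t (fun y => (f y `^ th)%:E) x <= ((D * t `^ (- kap) * N) `^ (th / r))%:E)%E.
Proof.
move=> th0 thr t0 mf f0 N0 fN.
have r0 : 0 < r by exact: lt_le_trans thr.
rewrite -[th / r]invrK invf_div.
apply: heat_jensen => //.
- by rewrite ler_pdivlMr ?mul1r.
- exact: (measurableT_comp (measurable_powR _)).
- by move=> y; exact: powR_ge0.
- by rewrite !mulr_ge0 ?powR_ge0// ltW.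
have -> : (fun y => ((f y `^ th) `^ (r / th))%:E) = (fun y => (f y `^ r)%:E).
  by apply/funext => y; rewrite -powRrM mulrC divfK// gt_eqF.
apply: (le_trans (heat_sup x t0 _ _)).
- by apply/measurable_EFinP; exact: (measurableT_comp (measurable_powR _)).
- by move=> y; rewrite lee_fin powR_ge0.
rewrite [X in (_ <= X)%E]EFinM; apply: lee_wpmul2l => //.
by rewrite lee_fin mulr_ge0 ?powR_ge0// ltW.
Qed.

(** By Jensen the power r/th of the flow of f^th is pointwise at most the flow of f^r, trivially
    where the latter is infinite; [heat_mass] then conserves the weighted integral. *)
Lemma heat_mass_Lr th r (f : T -> R) t : 0 < th -> th <= r -> 0 < t ->
  measurable_fun setT f -> (forall y, 0 <= f y) ->
  (\int[mu]_y (f y `^ r * w y)%:E < +oo)%E ->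
  (forall x, heat t (fun y => (f y `^ th)%:E) x < +oo)%E ->
  (\int[mu]_x (fine (heat t (fun y => (f y `^ th)%:E) x) `^ (r / th) * w x)%:E <=
   \int[mu]_y (f y `^ r * w y)%:E)%E.
Proof.
move=> th0 thr t0 mf f0 fN hfin.
have r0 : 0 < r by exact: lt_le_trans thr.
have mfq q : measurable_fun setT (fun y => (f y `^ q)%:E).
  by apply/measurable_EFinP; exact: (measurableT_comp (measurable_powR _)).
have fq0 q y : (0 <= (f y `^ q)%:E)%E by rewrite lee_fin powR_ge0.
have mh q : measurable_fun setT (heat t (fun y => (f y `^ q)%:E)) by exact: measurable_heat_slice.
have -> : (\int[mu]_y (f y `^ r * w y)%:E = \int[mu]_x (heat t (fun y => (f y `^ r)%:E) x * (w x)%:E))%E.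
  by rewrite heat_mass//; apply: eq_integral => y _; rewrite EFinM.
apply: ge0_le_integral.
- exact: measurableT.
- by move=> x _; rewrite lee_fin mulr_ge0 ?powR_ge0.
- apply/measurable_EFinP; apply: measurable_funM => //.
  apply: (measurableT_comp (measurable_powR _)).
  exact: (measurableT_comp (@fine_measurable _ setT measurableT) (mh th)).
- apply: emeasurable_funM => //; exact/measurable_EFinP.
move=> x _; rewrite EFinM; apply: lee_wpmul2r; first by rewrite lee_fin.
have h0 q : (0 <= heat t (fun y => (f y `^ q)%:E) x)%E by exact: heat_ge0.
case hr : (heat t (fun y => (f y `^ r)%:E) x) => [b| |]; last 2 first.
- by rewrite leey.
- by have := h0 r; rewrite hr.
have b0 : 0 <= b by have := h0 r; rewrite hr lee_fin.
have : (heat t (fun y => (f y `^ th)%:E) x <= (b `^ (r / th)^-1)%:E)%E.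
  apply: (@heat_jensen _ (fun y => f y `^ th)) => //.
  - by rewrite ler_pdivlMr ?mul1r.
  - exact: (measurableT_comp (measurable_powR _)).
  - by move=> y; exact: powR_ge0.
  rewrite -hr le_eqVlt; apply/orP; left; apply/eqP; congr (heat t _ x).
  by apply/funext => y; rewrite -powRrM mulrC divfK// gt_eqF.
rewrite lee_fin => h.
have q0 : 0 < r / th by rewrite divr_gt0.
have -> : b = (b `^ (r / th)^-1) `^ (r / th).
  by rewrite -powRrM mulVf ?gt_eqF// powRr1.
rewrite ge0_ler_powR ?nnegrE ?powR_ge0 ?(ltW q0)// ?fine_ge0//.
by rewrite -lee_fin fineK// ge0_fin_numE// hfin.
Qed.

(* Sum over the dyadic shells 2^j lam < f <= 2^(j+1) lam. *)
Lemma weak_tail th r del (f : T -> R) lam : 0 <= th < r -> 0 < del -> 0 < lam ->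
  measurable_fun setT f -> (forall y, 0 <= f y) ->
  (forall l, 0 < l -> (\int[mu]_(y in [set y | (l < f y)%R]) (w y)%:E <= ((del / l) `^ r)%:E)%E) ->
  (\int[mu]_(y in [set y | (lam < f y)%R]) (f y `^ th * w y)%:E <=
    (2 `^ th / (1 - 2 `^ (th - r)) * lam `^ (th - r) * del `^ r)%:E)%E.
Proof.
move=> /andP[th0 thr] del0 lam0 mf f0 fweak.
have mset (a : R) : measurable [set y | a < f y].
  rewrite -[X in measurable X]setTI (_ : [set y | a < f y] = f @^-1` `]a, +oo[); first exact: mf.
  by apply/seteqP; split => y; rewrite /= in_itv/= andbT.
have mset2 (a b : R) : measurable [set y | a < f y <= b].
  rewrite -[X in measurable X]setTI (_ : [set y | a < f y <= b] = f @^-1` `]a, b]); first exact: mf.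
  by apply/seteqP; split => y; rewrite /= in_itv/=.
have mI E : measurable_fun E (fun y => (f y `^ th * w y)%:E).
  apply/measurable_EFinP; apply: measurable_funTS; apply: measurable_funM => //.
  exact: (measurableT_comp (measurable_powR _)).
have I0 y : (0 <= (f y `^ th * w y)%:E)%E by rewrite lee_fin mulr_ge0 ?powR_ge0.
set q := 2 `^ (th - r).
have q0 : 0 < q by rewrite powR_gt0.
have q1 : q < 1 by rewrite powR2_lt1// subr_lt0.
set K := 2 `^ th * lam `^ (th - r) * del `^ r.
have K0 : 0 <= K by rewrite !mulr_ge0 ?powR_ge0.
have p2 j : 0 < 2 ^+ j * lam by rewrite mulr_gt0 ?exprn_gt0.
have shell j : (\int[mu]_(y in [set y | 2 ^+ j * lam < f y <= 2 ^+ j.+1 * lam]%R) (f y `^ th * w y)%:E <=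
    (K * q ^+ j)%:E)%E.
  apply: (@le_trans _ _ (\int[mu]_(y in [set y | 2 ^+ j * lam < f y <= 2 ^+ j.+1 * lam]%R)
     (((2 ^+ j.+1 * lam) `^ th)%:E * (w y)%:E))%E).
    apply: ge0_le_integral => //.
    - by apply: emeasurable_funM => //; apply/measurable_EFinP; exact: measurable_funTS.
    - move=> y /andP[_ fy]; rewrite -EFinM lee_fin ler_wpM2r// ge0_ler_powR ?nnegrE//.
      exact: ltW.
  rewrite ge0_integralZl_EFin ?powR_ge0//; last 2 first.
  - by move=> y _; rewrite lee_fin.
  - by apply/measurable_EFinP; exact: measurable_funTS.
  apply: (@le_trans _ _ (((2 ^+ j.+1 * lam) `^ th)%:E * ((del / (2 ^+ j * lam)) `^ r)%:E)%E).
    apply: lee_wpmul2l; first by rewrite lee_fin powR_ge0.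
    apply: le_trans (fweak _ (p2 j)); apply: ge0_subset_integral => //.
    - by apply/measurable_EFinP; exact: measurable_funTS.
    - by move=> y _; rewrite lee_fin.
    - by move=> y /andP[].
  rewrite -EFinM lee_fin /K /q.
  rewrite exprS -mulrA; have := p2 j; set P := 2 ^+ j * lam => P0.
  rewrite (@powRM _ 2 P) ?(ltW P0)// (@powRM _ del P^-1) ?invr_ge0 ?(ltW P0) ?(ltW del0)//.
  rewrite -[P^-1]powR_inv1 ?(ltW P0)// -powRrM mulN1r.
  have -> : 2 `^ th * P `^ th * (del `^ r * P `^ (- r)) =
      2 `^ th * (P `^ th * P `^ (- r)) * del `^ r by ring.
  rewrite -powRD; last by rewrite (gt_eqF P0) implybT.
  rewrite /P.
  rewrite powRM ?exprn_ge0 ?(ltW lam0)// -[in X in X <= _]powR_mulrn// -powRrM.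
  rewrite [j%:R * _]mulrC powRrM powR_mulrn ?powR_ge0//.
  by rewrite le_eqVlt; apply/orP; left; apply/eqP; ring.
(* The shells accumulate to [F j], compared with partial geometric sums; the sets [F j] increase to
   the whole tail. *)
pose F j := [set y | lam < f y <= 2 ^+ j * lam].
have partial j : (\int[mu]_(y in F j) (f y `^ th * w y)%:E <= (K * ((1 - q ^+ j) / (1 - q)))%:E)%E.
  elim: j => [|j IH].
    rewrite (_ : F 0%N = set0) ?integral_set0.
      by rewrite expr0 subrr mul0r mulr0.
    by apply/seteqP; split => y //; rewrite /F /= expr0 mul1r => /andP[/lt_le_trans h /h]; rewrite ltxx.
  have -> : F j.+1 = F j `|` [set y | 2 ^+ j * lam < f y <= 2 ^+ j.+1 * lam].
    apply/seteqP; split => y; rewrite /F /=.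
      move=> /andP[h1 h2]; have [h|h] := leP (f y) (2 ^+ j * lam); [left|right].
        by rewrite h1.
      by rewrite h2.
    have h2 : 2 ^+ j * lam <= 2 ^+ j.+1 * lam.
      by rewrite exprS -mulrA ler_peMl ?(ltW (p2 j))// ler1n.
    have h3 : lam <= 2 ^+ j * lam by rewrite ler_peMl ?(ltW lam0)// exprn_ege1// ler1n.
    move=> [|] /andP[h h']; apply/andP; split => //.
      exact: le_trans h2.
    exact: le_lt_trans h.
  rewrite ge0_integral_setU//; last 2 first.
  - exact: mset2.
  - apply/disj_setPS => y [/= /andP[_ h1] /andP[h2 _]].
    by have := lt_le_trans h2 h1; rewrite ltxx.
  apply: (le_trans (leeD IH (shell j))); rewrite -EFinD lee_fin le_eqVlt; apply/orP; left; apply/eqP.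
  by rewrite exprS; field; rewrite subr_eq0 eq_sym lt_eqF.
have -> : [set y | lam < f y] = \bigcup_j F j.
  apply/seteqP; split => y /=.
    move=> ly; exists (Num.truncn (f y / lam)).+1 => //; rewrite /F/= ly/=.
    rewrite -ler_pdivrMr// (le_trans (ltW (truncnS_gt _)))//.
    by rewrite -natrX ler_nat ltnW// ltn_expl.
  by move=> [j _]; rewrite /F /= => /andP[].
have cv : (\int[mu]_(y in F j) (f y `^ th * w y)%:E)%E @[j --> \oo] -->
   (\int[mu]_(y in \bigcup_j F j) (f y `^ th * w y)%:E)%E.
  apply: ge0_nondecreasing_set_cvg_integral => //.
  - move=> i j' ij; rewrite subsetEset => y; rewrite /F/= => /andP[-> h]/=.
    by rewrite (le_trans h)// ler_pM2r// ler_eXn2l// ltr1n.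
  - by move=> j; exact: mset2.
rewrite -(cvg_lim _ cv)//; apply: lime_le; first by apply/cvg_ex; eexists; exact: cv.
apply: nearW => j; apply: (le_trans (partial j)); rewrite lee_fin.
have -> : 2 `^ th / (1 - q) * lam `^ (th - r) * del `^ r = K * (1 / (1 - q)).
  by rewrite /K; ring.
apply: ler_wpM2l => //; rewrite ler_pM2r ?invr_gt0 ?subr_gt0//.
by rewrite gerBl exprn_ge0// ltW.
Qed.

(** For f in weak L^r with th < r the power f^th need not be integrable, but its part on f > a is.
    Elsewhere it is at most the constant a^th, which the flow preserves. *)
Lemma heat_tail_split th (f : T -> R) t x (a : R) : 0 < th -> 0 < t -> 0 <= a ->
  measurable_fun setT f -> (forall y, 0 <= f y) ->
  let g := (fun y => (f y `^ th)%:E) \_ [set y | a < f y] in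
  [/\ measurable_fun setT g, forall y, (0 <= g y)%E,
   (\int[mu]_y (g y * (w y)%:E) = \int[mu]_(y in [set y | (a < f y)%R]) (f y `^ th * w y)%:E)%E &
   (heat t (fun y => (f y `^ th)%:E) x <= (a `^ th)%:E + heat t g x)%E].
Proof.
move=> th0 t0 a0 mf f0 g.
have mset : measurable [set y | a < f y].
  rewrite -[X in measurable X]setTI (_ : [set y | a < f y] = f @^-1` `]a, +oo[); first exact: mf.
  by apply/seteqP; split => y; rewrite /= in_itv/= andbT.
have mfth : measurable_fun setT (fun y => (f y `^ th)%:E).
  by apply/measurable_EFinP; exact: (measurableT_comp (measurable_powR _)).
have mg : measurable_fun setT g.
  by apply/(measurable_restrictT _ _).1 => //; exact: measurable_funTS.
have g0 y : (0 <= g y)%E by rewrite /g patchE; case: ifP => // _; rewrite lee_fin powR_ge0.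
split => //.
  rewrite [RHS]integral_mkcond; apply: eq_integral => y _.
  by rewrite /g !patchE; case: ifP => // _; rewrite mul0e.
have c0 : (0 <= (a `^ th)%:E)%E by rewrite lee_fin powR_ge0.
rewrite -[X in (_ <= X + _)%E](heat_cst x t0 c0) -heatD//.
apply: le_heat => //.
- exact: emeasurable_funD.
- by move=> y; rewrite lee_fin powR_ge0.
- move=> y; rewrite /= /g patchE; case: ifPn => [_|].
    by rewrite leeDr.
  rewrite notin_setE /= => /negP; rewrite -leNgt => fya; rewrite adde0 lee_fin.
  by rewrite ge0_ler_powR ?nnegrE ?(ltW th0).
Qed.

Lemma heat_sup_weak th r del (f : T -> R) t x : 0 < th < r -> 0 < del -> 0 < t ->
  measurable_fun setT f -> (forall y, 0 <= f y) ->
  (forall l, 0 < l -> (\int[mu]_(y in [set y | (l < f y)%R]) (w y)%:E <= ((del / l) `^ r)%:E)%E) ->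
  (heat t (fun y => (f y `^ th)%:E) x <=
    ((1 + D * (2 `^ th / (1 - 2 `^ (th - r)))) * del `^ th * t `^ (- (kap * th / r)))%:E)%E.
Proof.
move=> /andP[th0 thr] del0 t0 mf f0 fweak.
have r0 : 0 < r by exact: lt_trans thr.
(* At this level the bounded part and the tail carry the same powers of [del] and [t]; they
   contribute the summands 1 and D * (...) of the constant. *)
pose a := del * t `^ (- (kap / r)).
have a0 : 0 < a by rewrite mulr_gt0// powR_gt0.
have [mg g0 gw hg] := heat_tail_split x th0 t0 (ltW a0) mf f0.
apply: (le_trans hg).
apply: (@le_trans _ _ ((a `^ th)%:E + (D * t `^ (- kap))%:E * (2 `^ th / (1 - 2 `^ (th - r)) * a `^ (th - r) * del `^ r)%:E)%E).
  apply: leeD2l; apply: (le_trans (heat_sup x t0 mg g0)).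
  apply: lee_wpmul2l; first by rewrite lee_fin mulr_ge0 ?powR_ge0// ltW.
  by rewrite gw; apply: weak_tail => //; rewrite ltW.
rewrite -EFinM -EFinD lee_fin.
have e1 : a `^ th = del `^ th * t `^ (- (kap * th / r)).
  by rewrite powRM ?powR_ge0 ?(ltW del0)// -powRrM; congr (_ * _ `^ _); ring.
have e2 : t `^ (- kap) * (a `^ (th - r) * del `^ r) = del `^ th * t `^ (- (kap * th / r)).
  rewrite powRM ?powR_ge0 ?(ltW del0)// -powRrM.
  have -> : t `^ (- kap) * (del `^ (th - r) * t `^ (- (kap / r) * (th - r)) * del `^ r) =
     (del `^ (th - r) * del `^ r) * (t `^ (- kap) * t `^ (- (kap / r) * (th - r))) by ring.
  rewrite -!powRD ?(gt_eqF t0) ?(gt_eqF del0) ?implybT//.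
  rewrite subrK; congr (_ * _ `^ _); field; exact: lt0r_neq0.
rewrite le_eqVlt; apply/orP; left; apply/eqP.
move: e1 e2; set A := a `^ th; set E := t `^ _; set E1 := t `^ _; set F := a `^ _; set Q := _ / (1 - _).
move=> -> e2.
have -> : D * E1 * (Q * F * del `^ r) = D * Q * (E1 * (F * del `^ r)) by ring.
by rewrite e2; ring.
Qed.

(** A Marcinkiewicz argument: cut f at the level [a] with a^th = lam^th / 2. Where the flow exceeds
    lam^th, the flow of the tail exceeds half of that; Markov's inequality and conservation of mass
    reduce the claim to the integral of the tail. *)
Lemma heat_weak_Lr th r del (f : T -> R) t lam : 0 < th < r -> 0 < del -> 0 < t -> 0 < lam ->
  measurable_fun setT f -> (forall y, 0 <= f y) ->
  (forall l, 0 < l -> (\int[mu]_(y in [set y | (l < f y)%R]) (w y)%:E <= ((del / l) `^ r)%:E)%E) ->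
  (\int[mu]_(x in [set x | ((lam `^ th)%:E < heat t (fun y => (f y `^ th)%:E) x)]) (w x)%:E <=
    (2 `^ th / (1 - 2 `^ (th - r)) * 2 `^ (r / th) * (del / lam) `^ r)%:E)%E.
Proof.
move=> /andP[th0 thr] del0 t0 lam0 mf f0 fweak.
have r0 : 0 < r by exact: lt_trans thr.
pose a := (lam `^ th / 2) `^ th^-1.
have lth : 0 < lam `^ th by rewrite powR_gt0.
have a0 : 0 < a by rewrite powR_gt0// divr_gt0.
have ath : a `^ th = lam `^ th / 2.
  by rewrite /a -powRrM mulVf ?gt_eqF// powRr1// divr_ge0// ltW.
pose g := (fun y => (f y `^ th)%:E) \_ [set y | a < f y].
(* The three facts kept here do not involve the point, so any point serves. *)
have [mg g0 gw _] := heat_tail_split point th0 t0 (ltW a0) mf f0.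
have hg x : (heat t (fun y => (f y `^ th)%:E) x <= (lam `^ th / 2)%:E + heat t g x)%E.
  by have [_ _ _] := heat_tail_split x th0 t0 (ltW a0) mf f0; rewrite ath.
have mfth : measurable_fun setT (fun y => (f y `^ th)%:E).
  by apply/measurable_EFinP; exact: (measurableT_comp (measurable_powR _)).
have f00 y : (0 <= (f y `^ th)%:E)%E by rewrite lee_fin powR_ge0.
have mE : measurable [set x | ((lam `^ th)%:E < heat t (fun y => (f y `^ th)%:E) x)%E].
  rewrite -[X in measurable X]setTI.
  by apply: emeasurable_fun_o_infty => //; exact: measurable_heat_slice.
have mwE E : measurable_fun E (EFin \o w) by apply/measurable_EFinP; exact: measurable_funTS.
have l2 : 0 < 2 / lam `^ th by rewrite divr_gt0.
apply: (@le_trans _ _ ((2 / lam `^ th)%:E * \int[mu]_x (heat t g x * (w x)%:E))%E).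
  rewrite -ge0_integralZl_EFin ?(ltW l2)//; last 2 first.
  - by move=> x _; rewrite mule_ge0 ?lee_fin// heat_ge0.
  - by apply: emeasurable_funM; [exact: measurable_heat_slice|exact: mwE].
  rewrite [leLHS]integral_mkcond; apply: ge0_le_integral => //.
  - by move=> x _; rewrite patchE; case: ifP => // _; rewrite lee_fin.
  - by apply/(measurable_restrictT _ _).1.
  - apply: emeasurable_funM => //; apply: emeasurable_funM; [exact: measurable_heat_slice|exact: mwE].
  - move=> x _; rewrite patchE; case: ifPn => [|_]; last first.
      by rewrite !mule_ge0 ?lee_fin ?(ltW l2)// heat_ge0.
    rewrite inE/= => hx; rewrite muleA -[X in (X <= _)%E]mul1e.
    apply: lee_wpmul2r; first by rewrite lee_fin.
    have h := lt_le_trans hx (hg x).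
    case: (heat t g x) h => [h| |]; last 2 first.
    + by move=> _; rewrite gt0_muley ?lte_fin// leey.
    + by rewrite addeNy.
    rewrite -EFinD lte_fin -EFinM lee_fin => h'.
    by rewrite mulrAC ler_pdivlMr// mul1r; lra.
rewrite heat_mass// gw.
apply: (@le_trans _ _ ((2 / lam `^ th)%:E * (2 `^ th / (1 - 2 `^ (th - r)) * a `^ (th - r) * del `^ r)%:E)%E).
  apply: lee_wpmul2l; first by rewrite lee_fin ltW.
  by apply: weak_tail => //; rewrite ltW.
rewrite -EFinM lee_fin.
(* As 2 / lam^th is a^(-th), the left side is a^(-r); this is the origin of 2^(r/th). *)
have e1 : 2 / lam `^ th * a `^ (th - r) = 2 `^ (r / th) * lam `^ (- r).
  have -> : 2 / lam `^ th = (a `^ th)^-1 by rewrite ath invf_div.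
  rewrite -powRN -powRD ?(gt_eqF a0) ?implybT//.
  have -> : - th + (th - r) = th * (- (r / th)) by field; exact: lt0r_neq0.
  rewrite powRrM ath powRM ?powR_ge0 ?invr_ge0// mulrC.
  congr (_ * _).
    by rewrite -powR_inv1// -powRrM; congr (_ `^ _); ring.
  by rewrite -powRrM; congr (_ `^ _); field; exact: lt0r_neq0.
have -> : (del / lam) `^ r = lam `^ (- r) * del `^ r.
  rewrite powRM ?invr_ge0 ?(ltW lam0) ?(ltW del0)// mulrC; congr (_ * _).
  by rewrite -powR_inv1 ?(ltW lam0)// -powRrM mulN1r.
rewrite le_eqVlt; apply/orP; left; apply/eqP.
move: e1; set X := 2 / lam `^ th; set Y := a `^ _; set Q := _ / (1 - _) => e1.
have -> : X * (Q * Y * del `^ r) = (X * Y) * Q * del `^ r by ring.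
by rewrite e1; ring.
Qed.

(** The flow of u0^th stays below A^th, so [U] is at most 2A. This bound is uniform down to t = 0,
    where [B] may blow up, and places the solution in L^infinity. *)
Lemma global_solution th (B : R -> R) (u0 : T -> R) A : 1 <= th <= p ->
  measurable_fun setT u0 -> (forall x, 0 <= u0 x) ->
  0 <= A -> (\forall x \ae mu, u0 x <= A) ->
  measurable_fun setT B -> (forall t, 0 <= B t) ->
  (forall x t, 0 < t -> (heat t (fun y => (u0 y `^ th)%:E) x <= (B t)%:E)%E) ->
  (forall t, 0 < t -> ((2 `^ p * B t `^ (1 - th^-1))%:E *
     \int[@lebesgue_measure R]_(s in `]0%R, t[) (B s `^ (p / th - 1))%:E <= 1)%E) ->
  exists u, [/\ admissible u,
    forall x t, u x t <= 2 * fine (heat t (fun y => (u0 y `^ th)%:E) x) `^ th^-1,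
    forall x t, 0 < t -> u x t <= 2 * A &
    forall x t, (u x t)%:E = (heat t (EFin \o u0) x + duhamel u x t)%E].
Proof.
move=> thp mu0 u00 A0 uA mB B0 HB HI.
have [aU superU] := supersolution thp mu0 u00 mB B0 HB HI.
have [u [au uU ueq]] := supersolution_fixpoint mu0 u00 aU superU.
exists u; split => // x t t0.
move: thp => /andP[th1 _]; have th0 : 0 < th by rewrite (lt_le_trans _ th1).
apply: (le_trans (uU x t)); rewrite ler_wpM2l//.
rewrite -[leRHS](@powRr1 _ A)// -(mulfV (lt0r_neq0 th0)) powRrM.
rewrite ge0_ler_powR ?nnegrE ?invr_ge0 ?(ltW th0) ?powR_ge0//.
  by apply: fine_ge0; apply: heat_ge0 => y; rewrite lee_fin powR_ge0.
rewrite -lee_fin fineK; last first.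
  rewrite ge0_fin_numE; first by rewrite (le_lt_trans (HB x t t0))// ltry.
  by apply: heat_ge0 => y; rewrite lee_fin powR_ge0.
apply: heat_le_cst => //.
- by rewrite lee_fin powR_ge0.
- by apply/measurable_EFinP; exact: (measurableT_comp (measurable_powR _)).
- by move=> y; rewrite lee_fin powR_ge0.
- by apply: filterS uA => y uA; rewrite lee_fin ge0_ler_powR ?nnegrE// ltW.
Qed.
End heat.

(** * The weighted space *)

Section weighted_space.
Context {R : realType} {n : nat}.
Variable mu : {measure set (n.-tuple R) -> \bar R}.
Hypothesis mu_leb : is_lebesgue_Rn mu.

Lemma measurable_box (a b : n.-tuple R) :
  measurable [set x : n.-tuple R | forall i, tnth a i < tnth x i <= tnth b i].
Proof.
rewrite (_ : mkset _ = \bigcap_(i in [set: 'I_n]) ((fun x : n.-tuple R => tnth x i) @^-1` `]tnth a i, tnth b i])).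
  apply: fin_bigcap_measurable => //.
  move=> i _; rewrite -[X in measurable X]setTI.
  exact: (measurable_tnth i measurableT).
apply/seteqP; split => x /=.
  by move=> h i _; rewrite /= in_itv/=.
by move=> h i; have := h i I; rewrite /= in_itv/=.
Qed.

(** The cubes (-k, k]^n have finite volume and cover the space; Tonelli's theorem for the kernels
    rests on this. *)
Lemma lebesgue_Rn_sigma_finite : sigma_finite [set: n.-tuple R] mu.
Proof.
pose a (k : nat) (s : R) : n.-tuple R := [tuple s * k%:R | i < n].
exists (fun k => [set x : n.-tuple R | forall i, tnth (a k (-1)) i < tnth x i <= tnth (a k 1) i]).
  apply/seteqP; split => // x _.
  pose S := \sum_(i < n) `|tnth x i|.
  exists (Num.truncn S).+1 => // i /=.
  have h : `|tnth x i| < (Num.truncn S).+1%:R.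
    apply: le_lt_trans (truncnS_gt _).
    by rewrite /S (bigD1 i)//= lerDl sumr_ge0.
  rewrite !tnth_mktuple mulN1r mul1r.
  by move: h; rewrite ltr_norml => /andP[-> /ltW ->].
move=> k; split; first exact: measurable_box.
rewrite mu_leb ?ltry// => i; rewrite !tnth_mktuple mulN1r mul1r.
by rewrite (@le_trans _ _ 0)// oppr_le0.
Qed.

Lemma measurable_sqrt : measurable_fun setT (@Num.sqrt R).
Proof. by apply: continuous_measurable_fun; exact: sqrt_continuous. Qed.

Lemma measurable_weight caseA alpha : (1 <= n)%N ->
  measurable_fun [set: n.-tuple R] (weight caseA alpha).
Proof.
move=> n1; rewrite /weight; case: caseA; apply: (measurableT_comp (measurable_powR _)).
  apply: measurableT_comp => //.
  rewrite (_ : (fun x => _) = (fun x : n.-tuple R => tnth x (Ordinal n1))); last first.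
    by apply/funext => x; rewrite (tnth_nth 0).
  exact: measurable_tnth.
apply: (measurableT_comp measurable_sqrt).
apply: measurable_sum => i; apply: measurable_funX; exact: measurable_tnth.
Qed.

Lemma weight_ge0 caseA alpha (x : n.-tuple R) : 0 <= weight caseA alpha x.
Proof. by rewrite /weight; case: caseA; exact: powR_ge0. Qed.

(** The common lower bound that serves both weights: |x| >= |x_1|. *)
Lemma weight_ge_coord caseA alpha (i0 : 'I_n) (x : n.-tuple R) : i0 = 0%N :> nat -> 0 <= alpha ->
  `|tnth x i0| `^ alpha <= weight caseA alpha x.
Proof.
move=> i00 a0; rewrite /weight; case: caseA.
  by rewrite (tnth_nth 0) i00.
rewrite ge0_ler_powR ?nnegrE ?sqrtr_ge0// -sqrtr_sqr ler_wsqrtr//.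
rewrite (bigD1 i0)//= lerDl sumr_ge0// => i _; exact: sqr_ge0.
Qed.

Lemma measurable_edist (x : n.-tuple R) : measurable_fun setT (Defs.edist x).
Proof.
apply: (measurableT_comp measurable_sqrt).
apply: measurable_sum => i; apply: measurable_funX; apply: measurable_funB => //.
exact: measurable_tnth.
Qed.

Lemma measurable_ball (x : n.-tuple R) r : measurable [set z | Defs.edist x z < r].
Proof.
rewrite -[X in measurable X]setTI.
have -> : [set z | Defs.edist x z < r] = Defs.edist x @^-1` `]-oo, r[.
  by apply/seteqP; split => z; rewrite /= in_itv.
exact: (measurable_edist x measurableT).
Qed.

(* The ball contains a cube of side [s] on which |x_1| >= s. *)
Lemma wmeas_ball_ge caseA alpha (x : n.-tuple R) t : (1 <= n)%N -> 0 <= alpha -> 0 < t ->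
  (((Num.sqrt t / (2 * n.+1%:R)) `^ (n%:R + alpha))%:E <=
    wmeas mu (weight caseA alpha) [set z | (Defs.edist x z < Num.sqrt t)%R])%E.
Proof.
move=> n1 a0 t0; set s := _ / _.
have s0 : 0 < s by rewrite divr_gt0 ?sqrtr_gt0// mulr_gt0.
pose i0 : 'I_n := Ordinal n1.
(* The cube is shifted away from the hyperplane x_1 = 0, to the side on which [x] lies. Its points
   differ from [x] by at most 2s in each coordinate, and n (2s)^2 < t by the choice of [s]. *)
pose e : R := if 0 <= tnth x i0 then s else - (2 * s).
pose a : n.-tuple R := [tuple tnth x i + e | i < n].
pose b : n.-tuple R := [tuple tnth x i + e + s | i < n].
pose Q := [set z : n.-tuple R | forall i, tnth a i < tnth z i <= tnth b i].
have mQ : measurable Q by exact: measurable_box.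
have muQ : mu Q = (s ^+ n)%:E.
  rewrite mu_leb; last by move=> i; rewrite !tnth_mktuple lerDl ltW.
  congr EFin; rewrite (eq_bigr (fun=> s)).
    by rewrite prodr_const card_ord.
  by move=> i _; rewrite !tnth_mktuple addrAC subrr add0r.
have QB : Q `<=` [set z | Defs.edist x z < Num.sqrt t].
  move=> z Qz; rewrite /= /Defs.edist ltr_sqrt//.
  apply: (@le_lt_trans _ _ (\sum_(i < n) (2 * s) ^+ 2)).
    apply: ler_sum => i _; have := Qz i; rewrite !tnth_mktuple => /andP[h1 h2].
    rewrite -[leLHS]real_normK ?num_real// ler_sqr ?nnegrE ?normr_ge0 ?mulr_ge0 ?(ltW s0)//.
    rewrite ler_norml; move: h1 h2; rewrite /e; case: ifP => _; lra.
  have -> : 2 * s = Num.sqrt t / n.+1%:R.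
    by rewrite /s; field; rewrite nat1r pnatr_eq0.
  rewrite sumr_const card_ord.
  rewrite exprMn sqr_sqrtr ?(ltW t0)// -mulrnAr gtr_pMr// exprVn -mulr_natr mulrC.
  by rewrite ltr_pdivrMr ?exprn_gt0// mul1r -natrX ltr_nat; nia.
apply: (@le_trans _ _ (wmeas mu (weight caseA alpha) Q)); last first.
  apply: ge0_subset_integral => //.
  - exact: measurable_ball.
  - by apply/measurable_EFinP; apply: measurable_funTS; exact: measurable_weight.
  - by move=> z _; rewrite lee_fin weight_ge0.
apply: (@le_trans _ _ (\int[mu]_(z in Q) (s `^ alpha)%:E)%E); last first.
  apply: ge0_le_integral => //.
  - by move=> z _; rewrite lee_fin powR_ge0.
  - by apply/measurable_EFinP; apply: measurable_funTS; exact: measurable_weight.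
  - move=> z Qz; rewrite lee_fin; apply: le_trans (@weight_ge_coord _ _ i0 _ erefl a0).
    rewrite ge0_ler_powR ?nnegrE ?normr_ge0 ?(ltW s0)//.
    have := Qz i0; rewrite !tnth_mktuple => /andP[h1 h2].
    move: h1 h2; rewrite /e; case: ifP => [x0|/negbT]; last rewrite -ltNge => x0.
      by move=> h1 _; rewrite ler_normr; apply/orP; left; lra.
    by move=> _ h2; rewrite ler_normr; apply/orP; right; lra.
rewrite integral_cst// muQ -EFinM lee_fin -powR_mulrn ?(ltW s0)// -powRD; last first.
  by rewrite (gt_eqF s0) implybT.
by rewrite addrC.
Qed.

(** The Gaussian factor in the upper bound of (K3) is at most 1, and both ball measures are bounded
    below by [wmeas_ball_ge]. The strictly positive lower bound of (K3) gives the sign of [Gamma]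
    and keeps the product of ball measures from vanishing. *)
Lemma heat_kernel_bound caseA alpha Gamma : (1 <= n)%N -> 0 <= alpha ->
  kernel_assumptions mu (weight caseA alpha) Gamma ->
  exists D : R, 0 < D /\ forall x y t, 0 < t ->
    0 <= Gamma x y t <= D * t `^ (- ((n%:R + alpha) / 2)).
Proof.
move=> n1 a0 [_ [_ [_ [cs [Cs [cs0 [Cs0 H]]]]]]].
set w := weight caseA alpha in H *.
pose c : R := (2 * n.+1%:R)^-1 `^ (n%:R + alpha).
have c0 : 0 < c by rewrite powR_gt0// invr_gt0 mulr_gt0.
exists (Cs / c); split; first by rewrite divr_gt0.
move=> x y t t0; have := H x y t t0.
set wB := (fun z => fine _) => /=.
move=> /andP[lo up].
have wB0 z : 0 <= wB z.
  by apply: fine_ge0; apply: integral_ge0 => z' _; rewrite lee_fin weight_ge0.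
have pos : 0 < Num.sqrt (wB x * wB y) * Gamma x y t.
  by apply: lt_le_trans lo; rewrite mulr_gt0 ?expR_gt0.
have sq : 0 < Num.sqrt (wB x * wB y).
  rewrite lt_neqAle sqrtr_ge0 andbT; apply/eqP => h.
  by move: pos; rewrite -h mul0r ltxx.
have G0 : 0 < Gamma x y t by move: pos; rewrite pmulr_rgt0.
rewrite (ltW G0)/=.
move: sq; rewrite sqrtr_gt0 => ww.
(* [fine] is 0 on +oo, which the lower bound of (K3) excludes *)
have wBge z : wB z != 0 -> c * t `^ ((n%:R + alpha) / 2) <= wB z.
  move=> wBz; have := @wmeas_ball_ge caseA alpha z t n1 a0 t0.
  rewrite -/w => h.
  have -> : c * t `^ ((n%:R + alpha) / 2) = (Num.sqrt t / (2 * n.+1%:R)) `^ (n%:R + alpha).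
    rewrite powRM ?sqrtr_ge0 ?invr_ge0 ?mulr_ge0//.
    by rewrite mulrC -(powR12_sqrt (ltW t0)) -powRrM [2^-1 * _]mulrC.
  rewrite -lee_fin /wB fineK//; rewrite /wB in wBz.
  by case: (wmeas _ _ _) wBz h => //= ; rewrite eqxx.
have wx : wB x != 0 by apply: contraTneq ww => ->; rewrite mul0r ltxx.
have wy : wB y != 0 by apply: contraTneq ww => ->; rewrite mulr0 ltxx.
have tk : 0 < t `^ ((n%:R + alpha) / 2) by rewrite powR_gt0.
have hs : c * t `^ ((n%:R + alpha) / 2) <= Num.sqrt (wB x * wB y).
  rewrite -[leLHS]ger0_norm ?mulr_ge0 ?powR_ge0// -sqrtr_sqr ler_wsqrtr// expr2.
  by apply: ler_pM; rewrite ?mulr_ge0 ?powR_ge0 ?wBge.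
rewrite powRN -mulrA -invfM ler_pdivlMr ?mulr_gt0//.
rewrite mulrC; apply: (le_trans (ler_wpM2r (ltW G0) hs)).
apply: (le_trans up); rewrite ger_pMr// -expR0 ler_expR.
by rewrite mulNr oppr_le0 divr_ge0 ?sqr_ge0// mulr_ge0 ?ltW.
Qed.
End weighted_space.

(** * Distribution functions and interpolation of weighted norms *)

Section weighted_norms.
Context {R : realType} {n : nat}.
Variable mu : {measure set (n.-tuple R) -> \bar R}.
Variable w : n.-tuple R -> R.
Hypothesis mw : measurable_fun setT w.
Hypothesis w_ge0 : forall x, 0 <= w x.

Lemma measurable_superlevel (f : n.-tuple R -> R) (l : R) : measurable_fun setT f ->
  measurable [set x | l < `|f x|].
Proof.
move=> mf; rewrite -[X in measurable X]setTI.
have -> : [set x | l < `|f x|] = (fun x => `|f x|) @^-1` `]l, +oo[.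
  by apply/seteqP; split => y; rewrite /= in_itv/= andbT.
by apply: (measurableT_comp _ mf).
Qed.

Lemma distrib_antitone (f : n.-tuple R -> R) (l l' : R) : measurable_fun setT f -> l <= l' ->
  (distrib mu w f l' <= distrib mu w f l)%E.
Proof.
move=> mf ll'; apply: ge0_subset_integral.
- exact: measurable_superlevel.
- exact: measurable_superlevel.
- by apply/measurable_EFinP; exact: measurable_funTS.
- by move=> x _; rewrite lee_fin.
- by move=> x /=; exact: le_lt_trans.
Qed.

(** At s = (del/l)^q the strict norm bound says that the rearrangement is below l, so some level
    smaller than l already has measure at most s, and antitonicity carries this to l. *)
Lemma distrib_le_of_Lweak (q del : R) (f : n.-tuple R -> R) : 0 < q -> 0 < del ->
  measurable_fun setT f -> (Lweak mu w q%:E f < del%:E)%E ->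
  forall l, 0 < l -> (distrib mu w f l <= ((del / l) `^ q)%:E)%E.
Proof.
move=> q0 del0 mf H l l0.
have dl0 : 0 < del / l by rewrite divr_gt0.
set s := (del / l) `^ q.
have s0 : 0 < s by rewrite powR_gt0.
have sq : s `^ q^-1 = del / l by rewrite /s -powRrM mulfV ?gt_eqF// powRr1// ltW.
have h1 : ((s `^ q^-1)%:E * rearr mu w f s < del%:E)%E.
  by apply: le_lt_trans H; apply: ereal_sup_ubound; exists s.
have : (rearr mu w f s < l%:E)%E.
  have -> : (l%:E = ((del / l)^-1)%:E * del%:E)%E.
    by rewrite -EFinM; congr EFin; field; rewrite !gt_eqF.
  by rewrite lte_pdivlMl// -sq.
move=> /ereal_inf_lt[_ [l' [l'0 h2] <-]]; rewrite lte_fin => l'l.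
exact: le_trans (distrib_antitone mf (ltW l'l)) h2.
Qed.

(** Serves the endpoint r = rs of (ii), where L^r data are treated as weak L^r data. *)
Lemma chebyshev_distrib (r del : R) (f : n.-tuple R -> R) : 0 < r -> 0 <= del ->
  measurable_fun setT f -> (\int[mu]_x (`|f x| `^ r * w x)%:E <= (del `^ r)%:E)%E ->
  forall l, 0 < l -> (distrib mu w f l <= ((del / l) `^ r)%:E)%E.
Proof.
move=> r0 del0 mf H l l0.
have lr : 0 < l `^ r by rewrite powR_gt0.
have mI : measurable_fun setT (fun x => (`|f x| `^ r * w x)%:E).
  apply/measurable_EFinP; apply: measurable_funM => //; apply: (measurableT_comp (measurable_powR _)).
  exact: measurableT_comp.
have I0 x : (0 <= (`|f x| `^ r * w x)%:E)%E by rewrite lee_fin mulr_ge0 ?powR_ge0.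
have mE := measurable_superlevel l mf.
apply: (@le_trans _ _ (((l `^ r)^-1)%:E * \int[mu]_x (`|f x| `^ r * w x)%:E)%E).
  rewrite -ge0_integralZl_EFin ?invr_ge0 ?powR_ge0//.
  apply: (@le_trans _ _ (\int[mu]_(x in [set x | (l < `|f x|)%R]) (((l `^ r)^-1)%:E * (`|f x| `^ r * w x)%:E))%E).
    apply: ge0_le_integral => //.
    - by move=> x _; rewrite lee_fin.
    - by apply/measurable_EFinP; exact: measurable_funTS.
    - by apply: emeasurable_funM => //; exact: measurable_funTS.
    - move=> x /= lx; rewrite -EFinM lee_fin mulrA ler_peMl// mulrC ler_pdivlMr// mul1r.
      by rewrite ge0_ler_powR ?nnegrE ?(ltW r0) ?(ltW l0) ?(ltW lx).
  apply: ge0_subset_integral => //.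
  - by apply: emeasurable_funM.
  - by move=> x _; rewrite mule_ge0// lee_fin invr_ge0 powR_ge0.
apply: (@le_trans _ _ (((l `^ r)^-1)%:E * (del `^ r)%:E)%E).
  by apply: lee_wpmul2l => //; rewrite lee_fin invr_ge0 powR_ge0.
rewrite -EFinM lee_fin powRM ?invr_ge0 ?(ltW l0)// mulrC.
by rewrite -[l^-1]powR_inv1 ?(ltW l0)// -powRrM mulN1r powRN.
Qed.

Lemma Lweak_le (r q c M : R) (f : n.-tuple R -> R) : 0 < r <= q -> 0 < c -> 0 < M ->
  (forall x, `|f x| <= M) ->
  (forall l, 0 < l -> (distrib mu w f l <= ((c / l) `^ r)%:E)%E) ->
  (Lweak mu w q%:E f <= (M `^ (1 - r / q) * c `^ (r / q))%:E)%E.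
Proof.
move=> /andP[r0 rq] c0 M0 fM H.
have q0 : 0 < q by exact: lt_le_trans rq.
apply: ge_ereal_sup => _ [s /= s0 <-].
set K := M `^ (1 - r / q) * c `^ (r / q).
have K0 : 0 < K by rewrite mulr_gt0 ?powR_gt0.
have sq : 0 < s `^ q^-1 by rewrite powR_gt0.
(* The level at which s^(1/q) l equals the claimed bound. If l >= M the superlevel set is empty; if
   l < M, then l^(q-r) <= M^(q-r) turns the weak L^r bound into measure at most s. *)
pose l := K / s `^ q^-1.
have l0 : 0 < l by rewrite divr_gt0.
have -> : (K%:E = (s `^ q^-1)%:E * l%:E)%E.
  by rewrite -EFinM /l mulrC divfK ?gt_eqF.
apply: lee_wpmul2l; first by rewrite lee_fin powR_ge0.
apply: ereal_inf_lbound; exists l => //; split => //.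
have [Ml|lM] := leP M l.
  rewrite /distrib (_ : [set x | l < `|f x|] = set0).
    by rewrite /wmeas integral_set0 lee_fin ltW.
  apply/seteqP; split => x //= lx.
  by have := lt_le_trans lx (le_trans (fM x) Ml); rewrite ltxx.
apply: (le_trans (H l l0)); rewrite lee_fin.
have Kq : K `^ q = M `^ (q - r) * c `^ r.
  rewrite powRM ?powR_ge0// -!powRrM; congr (_ `^ _ * _ `^ _); field; exact: lt0r_neq0.
have sE : s = K `^ q / l `^ q.
  have -> : K = s `^ q^-1 * l by rewrite /l mulrC divfK ?gt_eqF.
  rewrite powRM ?powR_ge0 ?(ltW l0)// mulfK ?gt_eqF ?powR_gt0//.
  by rewrite -powRrM mulVf ?gt_eqF// powRr1// ltW.
rewrite sE Kq powRM ?invr_ge0 ?(ltW l0) ?(ltW c0)// -[l^-1]powR_inv1 ?(ltW l0)// -powRrM mulN1r.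
rewrite ler_pdivlMr ?powR_gt0// -mulrA -powRD ?(gt_eqF l0) ?implybT// mulrC ler_pM2r ?powR_gt0//.
by rewrite addrC ge0_ler_powR ?nnegrE ?subr_ge0 ?(ltW l0) ?(ltW M0) ?(ltW lM).
Qed.

Lemma Lw_le (r q N M : R) (f : n.-tuple R -> R) : 0 < r <= q -> 0 <= N -> 0 < M ->
  measurable_fun setT f -> (forall x, `|f x| <= M) ->
  (\int[mu]_x (`|f x| `^ r * w x)%:E <= N%:E)%E ->
  (Lw mu w q%:E f <= (M `^ (1 - r / q) * N `^ q^-1)%:E)%E.
Proof.
move=> /andP[r0 rq] N0 M0 mf fM H.
have q0 : 0 < q by exact: lt_le_trans rq.
have mI a : measurable_fun setT (fun x => (`|f x| `^ a * w x)%:E).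
  apply/measurable_EFinP; apply: measurable_funM => //; apply: (measurableT_comp (measurable_powR _)).
  exact: measurableT_comp.
have I0 a x : (0 <= (`|f x| `^ a * w x)%:E)%E by rewrite lee_fin mulr_ge0 ?powR_ge0.
have h : (\int[mu]_x (`|f x| `^ q * w x)%:E <= (M `^ (q - r) * N)%:E)%E.
  apply: (@le_trans _ _ ((M `^ (q - r))%:E * \int[mu]_x (`|f x| `^ r * w x)%:E)%E); last first.
    by rewrite EFinM; apply: lee_wpmul2l => //; rewrite lee_fin powR_ge0.
  rewrite -ge0_integralZl_EFin ?powR_ge0//; apply: ge0_le_integral => //.
    by apply: emeasurable_funM.
  move=> x _; rewrite -EFinM lee_fin mulrA ler_wpM2r//.
  have -> : `|f x| `^ q = `|f x| `^ (q - r) * `|f x| `^ r.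
    by rewrite -powRD ?subrK// gt_eqF.
  by rewrite ler_wpM2r ?powR_ge0// ge0_ler_powR ?nnegrE ?subr_ge0 ?(ltW M0).
rewrite /Lw; apply: (@le_trans _ _ (poweR (M `^ (q - r) * N)%:E q^-1)).
  apply: gt0_ler_poweR => //.
  - by rewrite invr_ge0 ltW.
  - by rewrite in_itv/= leey andbT integral_ge0.
  - by rewrite in_itv/= leey andbT lee_fin mulr_ge0 ?powR_ge0.
rewrite poweR_EFin lee_fin powRM ?powR_ge0// -powRrM.
by have -> : (q - r) / q = 1 - r / q by field; exact: lt0r_neq0.
Qed.

Lemma Linf_le (A : R) (f : n.-tuple R -> R) :
  (\forall x \ae mu, `|f x| <= A) -> (Linf mu f <= A%:E)%E.
Proof. by move=> H; apply/ess_supP; apply: filterS H => x; rewrite lee_fin. Qed.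

Lemma ae_le_Linf (f : n.-tuple R -> R) : (Linf mu f < +oo)%E ->
  \forall x \ae mu, `|f x| <= fine (Linf mu f).
Proof.
move=> H; have /ess_supP : (Linf mu f <= (fine (Linf mu f))%:E)%E.
  by case: (Linf mu f) H => //= _; rewrite leNye.
by apply: filterS => x; rewrite lee_fin.
Qed.

(** A finite negative essential supremum would make the whole space null, and then a smaller
    constant would also be an essential bound, a contradiction; [fine] sends the value -oo to 0. *)
Lemma fine_Linf_ge0 (f : n.-tuple R -> R) : (Linf mu f < +oo)%E -> 0 <= fine (Linf mu f).
Proof.
move=> H; have hae := ae_le_Linf H.
case E : (Linf mu f) H hae => [a| |]//= _ hae; rewrite leNgt; apply/negP => a0.
have : (Linf mu f <= (a - 1)%:E)%E.
  apply: Linf_le; apply: filterS hae => x h; exfalso.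
  by have := le_lt_trans h a0; rewrite normr_lt0.
by rewrite E lee_fin; lra.
Qed.
End weighted_norms.

(** * The Cauchy problem for the weighted kernel *)

Section cauchy_problem.
Context {R : realType} {n : nat}.
Variable mu : {sigma_finite_measure set (n.-tuple R) -> \bar R}.
Variable w : n.-tuple R -> R.
Variable Gamma : n.-tuple R -> n.-tuple R -> R -> R.
Variables p D kap : R.
Hypothesis mw : measurable_fun setT w.
Hypothesis w_ge0 : forall x, 0 <= w x.
Hypothesis KA : kernel_assumptions mu w Gamma.
Hypothesis D_gt0 : 0 < D.
Hypothesis kap_gt0 : 0 < kap.
Hypothesis GD : forall x y t, 0 < t -> 0 <= Gamma x y t <= D * t `^ (- kap).
Hypothesis p_gt1 : 1 < p.

(* The weight is absorbed in the kernel, which is extended by 0 to t <= 0. *)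
Definition wkernel x y t := if 0 < t then Gamma x y t * w y else 0.

Lemma measurable_wkernel : measurable_fun setT (fun z : (n.-tuple R * n.-tuple R) * R => wkernel z.1.1 z.1.2 z.2).
Proof.
have [mG _] := KA.
apply: measurable_fun_ifT.
- exact: measurable_fun_ltr.
- apply: measurable_funM; first exact: mG.
  by apply: (measurableT_comp mw); exact: (measurableT_comp measurable_snd measurable_fst).
- exact: measurable_cst.
Qed.

Lemma wkernel_ge0 x y t : 0 <= wkernel x y t.
Proof.
rewrite /wkernel; case: ifP => // t0; rewrite mulr_ge0//.
by have /andP[] := GD x y t0.
Qed.

Lemma wkernel_neg x y t : t <= 0 -> wkernel x y t = 0.
Proof. by rewrite /wkernel leNgt; case: ifP. Qed.

Lemma wkernel_mass x t : 0 < t -> (\int[mu]_y (wkernel x y t)%:E = 1)%E.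
Proof.
move=> t0; have [_ [K1 _]] := KA; have [_ <-] := K1 x x t t0.
by apply: eq_integral => y _; rewrite /wkernel t0.
Qed.

Lemma wkernel_adjoint y t : 0 < t -> (\int[mu]_x (wkernel x y t * w x)%:E = (w y)%:E)%E.
Proof.
move=> t0; have [mG [K1 _]] := KA.
transitivity ((w y)%:E * \int[mu]_x (Gamma x y t * w x)%:E)%E.
  rewrite -ge0_integralZl_EFin//.
  - by apply: eq_integral => x _; rewrite /wkernel t0 -EFinM; congr EFin; ring.
  - by move=> x _; rewrite lee_fin mulr_ge0//; have /andP[] := GD x y t0.
  - apply/measurable_EFinP; apply: measurable_funM => //.
    have mp : measurable_fun setT (fun x : n.-tuple R => ((x, y), t)).
      by apply: measurable_fun_pair => //; exact: measurable_fun_pair.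
    exact: (measurableT_comp mG mp).
by have [-> _] := K1 y y t t0; rewrite mule1.
Qed.

Lemma wkernel_semi x y t s : 0 < t -> 0 < s ->
  ((wkernel x y (t + s))%:E = \int[mu]_z (wkernel x z t * wkernel z y s)%:E)%E.
Proof.
move=> t0 s0; have [mG [K1 [K2 _]]] := KA.
have ts : 0 < t + s by rewrite addr_gt0.
have sts : s < t + s by rewrite ltrDr.
rewrite /wkernel ts t0 s0 EFinM (K2 x y _ _ s0 sts) addrK muleC.
have mGc (f g : n.-tuple R -> n.-tuple R) a : measurable_fun setT f -> measurable_fun setT g ->
    measurable_fun setT (fun z => Gamma (f z) (g z) a).
  move=> mf mg.
  have mp : measurable_fun setT (fun z => ((f z, g z), a)).
    by apply: measurable_fun_pair => //; exact: measurable_fun_pair.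
  exact: (measurableT_comp mG mp).
rewrite -ge0_integralZl_EFin//.
- by apply: eq_integral => z _; rewrite -EFinM; congr EFin; ring.
- move=> z _; rewrite lee_fin !mulr_ge0//.
    by have /andP[] := GD x z t0.
  by have /andP[] := GD z y s0.
- by apply/measurable_EFinP; do 2! apply: measurable_funM => //; exact: mGc.
Qed.

Lemma wkernel_sup x y t : 0 < t -> wkernel x y t <= D * t `^ (- kap) * w y.
Proof. by move=> t0; rewrite /wkernel t0 ler_wpM2r//; have /andP[] := GD x y t0. Qed.

Let p_ge1 : 1 <= p := ltW p_gt1.

(** A solution is constrained only at positive times, so [u] may be traded for an admissible [v]
    that agrees with it there. *)
Lemma mild_equation (u0 : n.-tuple R -> R) (u v : n.-tuple R -> R -> R) x t : 0 < t ->
  admissible v -> (forall y s, 0 < s -> u y s = v y s) ->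
  (\int[mu]_y ((Gamma x y t * u0 y * w y)%:E) +
        \int[(@lebesgue_measure R)]_(s in [set s : R | 0 < s < t]%R)
           \int[mu]_y ((Gamma x y (t - s) * (u y s `^ p) * w y)%:E))%E =
  (heat mu wkernel t (EFin \o u0) x + duhamel mu wkernel p v x t)%E.
Proof.
move=> t0 av uv; congr (_ + _)%E.
  by apply: eq_integral => y _; rewrite /wkernel t0 -EFinM; congr EFin; ring.
rewrite (duhamelE mu wkernel_neg p_ge1 x t av) set_itvoo.
apply: eq_integral => s; rewrite inE/= => /andP[s0 st]; apply: eq_integral => y _.
by rewrite /wkernel subr_gt0 st -EFinM uv//; congr EFin; ring.
Qed.

Lemma solution_exists_unique th (B : R -> R) (u0 : n.-tuple R -> R) A : 1 <= th <= p ->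
  measurable_fun setT u0 -> (forall x, 0 <= u0 x) ->
  0 <= A -> (\forall x \ae mu, u0 x <= A) ->
  measurable_fun setT B -> (forall t, 0 <= B t) ->
  (forall x t, 0 < t -> (heat mu wkernel t (fun y => (u0 y `^ th)%:E) x <= (B t)%:E)%E) ->
  (forall t, 0 < t -> ((2 `^ p * B t `^ (1 - th^-1))%:E *
     \int[@lebesgue_measure R]_(s in `]0%R, t[) (B s `^ (p / th - 1))%:E <= 1)%E) ->
  exists u, [/\ is_solution mu w Gamma p +oo u0 u,
    (forall v, is_solution mu w Gamma p +oo u0 v ->
       forall t, 0 < t -> \forall x \ae mu, v x t = u x t),
    forall t, measurable_fun setT (fun x => u x t),
    forall x t, 0 <= u x t &
    forall x t, 0 < t -> u x t <= 2 * A /\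
      u x t <= 2 * fine (heat mu wkernel t (fun y => (u0 y `^ th)%:E) x) `^ th^-1].
Proof.
move=> thp mu0 u00 A0 uA mB B0 HB HI.
have [u [au uV uA' ueq]] := global_solution measurable_wkernel wkernel_ge0 wkernel_neg
  wkernel_mass wkernel_semi p_ge1 thp mu0 u00 A0 uA mB B0 HB HI.
have [mu_ upos uneg] := au.
have mD : measurable [set z : n.-tuple R * R | 0 < z.2 /\ (z.2%:E < +oo)%E].
  rewrite -[X in measurable X]setTI.
  have -> : [set z : n.-tuple R * R | 0 < z.2 /\ (z.2%:E < +oo)%E] = snd @^-1` `]0, +oo[.
    apply/seteqP; split => z; rewrite /= in_itv/= andbT; first by case.
    by move=> ->; rewrite ltry.
  exact: (@measurable_snd _ _ _ _ measurableT).
exists u; split => //.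
- split; first exact: measurable_funTS.
  split; first by move=> x t _ _; exact: upos.
  split.
    exists (2 * A); apply: nearW => t t0 _; apply: Linf_le; apply: nearW => x.
    by rewrite ger0_norm// uA'.
  move=> t t0 _; apply: nearW => x.
  by rewrite (mild_equation u0 (v := u) x t0 au)// ueq.
- move=> v [mv [v0 [[M vM] veq]]] t t0.
  (* An arbitrary solution is uncontrolled at t <= 0; cutting it off there makes it admissible
     without changing the equation. *)
  pose v' x t := if 0 < t then v x t else 0.
  have vv' y s : 0 < s -> v y s = v' y s by rewrite /v' => ->.
  have av' : admissible v'.
    split.
    + have -> : (fun z : n.-tuple R * R => v' z.1 z.2) =
          (fun z => v z.1 z.2) \_ [set z | 0 < z.2 /\ (z.2%:E < +oo)%E].
        apply/funext => z; rewrite patchE /v'; case: ifPn => h.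
          by rewrite mem_set//= h ltry.
        by rewrite memNset//= => -[h' _]; rewrite h' in h.
      by apply/(measurable_restrictT _ _).1.
    + by move=> x s; rewrite /v'; case: ifP => // s0; apply: v0; rewrite ?ltry.
    + by move=> x s s0; rewrite /v' ltNge s0.
  (* A common bound for the two solutions compared. *)
  pose M' := Num.max M (2 * A).
  have M'0 : 0 <= M' by rewrite le_max mulr_ge0 ?orbT.
  have v'u : \forall x \ae mu, v' x t = u x t.
    apply: (@duhamel_unique _ _ _ mu wkernel measurable_wkernel wkernel_ge0 wkernel_neg wkernel_mass
      p p_ge1 (fun x t => heat mu wkernel t (EFin \o u0) x) v' u M' av' au M'0) => //.
    + move: vM; apply: (@filterS _ _ (ae_filter_ringOfSetsType _)) => s vM s0.
      have /ess_supP := vM s0 (ltry _); apply: filterS => y; rewrite lee_fin => h.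
      by rewrite -vv'// le_max (le_trans (ler_norm _) h).
    + by apply: nearW => s s0; apply: nearW => y; rewrite le_max uA' ?orbT.
    + move=> s s0; have := veq s s0 (ltry _); apply: filterS => x.
      by rewrite (mild_equation u0 x s0 av' vv') vv'.
    + by move=> s s0; apply: nearW => x; rewrite ueq.
  by apply: filterS v'u => x; rewrite vv'.
- move=> t; have mp : measurable_fun setT (fun x : n.-tuple R => (x, t)) by exact: measurable_fun_pair.
  exact: (measurableT_comp mu_ mp).
- by move=> x t t0; split; [exact: uA'|exact: uV].
Qed.

Let heat_fin th (u0 : n.-tuple R -> R) x t b : (heat mu wkernel t (fun y => (u0 y `^ th)%:E) x <= b%:E)%E ->
  fine (heat mu wkernel t (fun y => (u0 y `^ th)%:E) x) <= b.
Proof.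
move=> H; rewrite -lee_fin fineK// ge0_fin_numE; first exact: le_lt_trans H (ltry _).
by apply: (heat_ge0 mu wkernel_ge0) => y; rewrite lee_fin powR_ge0.
Qed.

(** The sup bound comes from Jensen and smoothing, the L^r bound from u <= 2 V^(1/th), with V the
    flow of u0^th, and from [heat_mass_Lr]; the other q follow by interpolation. The exponent [th]
    is left free because it is 1 for r < rs and larger at r = rs. *)
Lemma strong_decay r th (u0 : n.-tuple R -> R) (u : n.-tuple R -> R -> R) N A : 1 <= th <= r ->
  measurable_fun setT u0 -> (forall x, 0 <= u0 x) -> 0 <= N -> 0 <= A ->
  (\int[mu]_y (u0 y `^ r * w y)%:E <= N%:E)%E ->
  (forall t, measurable_fun setT (fun x => u x t)) -> (forall x t, 0 <= u x t) ->
  (forall x t, 0 < t -> u x t <= 2 * A /\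
      u x t <= 2 * fine (heat mu wkernel t (fun y => (u0 y `^ th)%:E) x) `^ th^-1) ->
  forall q : \bar R, (r%:E <= q)%E ->
    exists C : R, forall t : R, (0 < t)%R ->
      (((1 + t) `^ (kap * (r^-1 - einv q)))%:E * Lw mu w q (fun x => u x t) <= C%:E)%E.
Proof.
move=> /andP[th1 thr] mu0 u00 N0 A0 HN muS u_ge0 uV.
have th0 : 0 < th by exact: lt_le_trans th1.
have r0 : 0 < r by exact: lt_le_trans thr.
have HV x t : 0 < t -> (heat mu wkernel t (fun y => (u0 y `^ th)%:E) x <= ((D * t `^ (- kap) * N) `^ (th / r))%:E)%E.
  by move=> t0; apply: (heat_sup_Lr measurable_wkernel wkernel_ge0 wkernel_mass mw w_ge0 D_gt0 wkernel_sup).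
pose g := kap / r.
have g0 : 0 <= g by rewrite divr_ge0// ltW.
pose b := 2 * (D * N) `^ r^-1.
have b0 : 0 <= b by rewrite mulr_ge0 ?powR_ge0.
(* The summand 1 keeps [C1] positive even if [A] and [N] vanish. *)
pose C1 := (2 * A + 1 + b) * 2 `^ g.
have C10 : 0 < C1 by rewrite mulr_gt0 ?powR_gt0// ltr_wpDr// ltr_wpDl// mulr_ge0.
have sup x t : 0 < t -> `|u x t| <= C1 * (1 + t) `^ (- g).
  move=> t0; have [h1 h2] := uV x t t0; rewrite ger0_norm//.
  apply: decay_interpolate => //.
  - by rewrite addr_ge0// mulr_ge0.
  - by rewrite (le_trans h1)// lerDl.
  - apply: (le_trans h2); rewrite /b -mulrA ler_pM2l//.
    apply: (@le_trans _ _ (((D * t `^ (- kap) * N) `^ (th / r)) `^ th^-1)).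
      rewrite ge0_ler_powR ?nnegrE ?powR_ge0 ?invr_ge0 ?(ltW th0)//; last exact/heat_fin/HV.
      by apply: fine_ge0; apply: (heat_ge0 mu wkernel_ge0) => y; rewrite lee_fin powR_ge0.
    rewrite -powRrM.
    have -> : th / r * th^-1 = r^-1 by field; rewrite !gt_eqF.
    have -> : D * t `^ (- kap) * N = D * N * t `^ (- kap) by ring.
    rewrite powRM ?mulr_ge0 ?powR_ge0 ?(ltW D_gt0)//.
    by rewrite -[X in _ * X]powRrM mulNr.
have t1 t : 0 < t -> 0 < 1 + t :> R by move=> t0; rewrite addr_gt0.
case=> [q| |]//; last first.
  move=> _; exists C1 => t t0 /=; rewrite subr0.
  apply: (@le_trans _ _ (((1 + t) `^ (kap * r^-1))%:E * (C1 * (1 + t) `^ (- g))%:E)%E).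
    apply: lee_wpmul2l; first by rewrite lee_fin powR_ge0.
    by apply: Linf_le; apply: nearW => x; exact: sup.
  by rewrite -EFinM lee_fin mulrCA -powRD ?(gt_eqF (t1 t t0)) ?implybT// subrr powRr0 mulr1.
rewrite lee_fin => rq; have q0 : 0 < q by exact: lt_le_trans rq.
exists (C1 `^ (1 - r / q) * (2 `^ r * N) `^ q^-1) => t t0.
have HL : (\int[mu]_x (`|u x t| `^ r * w x)%:E <= (2 `^ r * N)%:E)%E.
  have mV : measurable_fun setT (fun x => fine (heat mu wkernel t (fun y => (u0 y `^ th)%:E) x) `^ (r / th)).
    apply: (measurableT_comp (measurable_powR _)).
    apply: (measurableT_comp (@fine_measurable _ setT measurableT)).
    apply: (measurable_heat_slice mu measurable_wkernel wkernel_ge0).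
      by apply/measurable_EFinP; exact: (measurableT_comp (measurable_powR _)).
    by move=> y; rewrite lee_fin powR_ge0.
  apply: (@le_trans _ _ ((2 `^ r)%:E * \int[mu]_x (fine (heat mu wkernel t (fun y => (u0 y `^ th)%:E) x) `^ (r / th) * w x)%:E)%E).
    rewrite -ge0_integralZl_EFin ?powR_ge0//; last 2 first.
    - by move=> x _; rewrite lee_fin mulr_ge0 ?powR_ge0.
    - by apply/measurable_EFinP; exact: measurable_funM.
    apply: ge0_le_integral => //.
    - by move=> x _; rewrite lee_fin mulr_ge0 ?powR_ge0.
    - apply/measurable_EFinP; apply: measurable_funM => //; apply: (measurableT_comp (measurable_powR _)).
      exact: measurableT_comp.
    - by apply: emeasurable_funM => //; apply/measurable_EFinP; exact: measurable_funM.
    - move=> x _; rewrite -EFinM lee_fin mulrA ler_wpM2r// ger0_norm//.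
      have [_ h2] := uV x t t0.
      have -> : r / th = th^-1 * r by rewrite mulrC.
      rewrite powRrM -powRM ?powR_ge0// ge0_ler_powR ?nnegrE ?mulr_ge0 ?powR_ge0//; exact: ltW.
  rewrite EFinM; apply: lee_wpmul2l; first by rewrite lee_fin powR_ge0.
  apply: (le_trans _ HN).
  apply: (heat_mass_Lr measurable_wkernel wkernel_ge0 wkernel_mass mw w_ge0 wkernel_adjoint) => //.
    exact: le_lt_trans HN (ltry _).
  by move=> x; exact: le_lt_trans (HV x t t0) (ltry _).
apply: (@le_trans _ _ (((1 + t) `^ (kap * (r^-1 - q^-1)))%:E *
   ((C1 * (1 + t) `^ (- (kap / r))) `^ (1 - r / q) * (2 `^ r * N) `^ q^-1)%:E)%E).
  apply: lee_wpmul2l; first by rewrite lee_fin powR_ge0.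
  apply: Lw_le => //.
  - by rewrite r0.
  - by rewrite mulr_ge0 ?powR_ge0.
  - by rewrite mulr_gt0 ?powR_gt0// t1.
  - by move=> x; exact: sup.
by rewrite -EFinM lee_fin mulrA decay_exponent// ltW.
Qed.

Let rs := kap * (p - 1).
Hypothesis rs_gt1 : 1 < rs.

(** Here [heat_sup_weak] supplies the sup decay and [heat_weak_Lr] the weak L^(rs) bound uniform in
    time; [Lweak_le] interpolates. *)
Lemma weak_decay th del (u0 : n.-tuple R -> R) (u : n.-tuple R -> R -> R) A : 1 < th < rs -> 0 < del ->
  measurable_fun setT u0 -> (forall x, 0 <= u0 x) -> 0 <= A ->
  (forall l, 0 < l -> (\int[mu]_(y in [set y | (l < u0 y)%R]) (w y)%:E <= ((del / l) `^ rs)%:E)%E) ->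
  (forall t, measurable_fun setT (fun x => u x t)) -> (forall x t, 0 <= u x t) ->
  (forall x t, 0 < t -> u x t <= 2 * A /\
      u x t <= 2 * fine (heat mu wkernel t (fun y => (u0 y `^ th)%:E) x) `^ th^-1) ->
  forall q : \bar R, (rs%:E <= q)%E ->
    exists C : R, forall t : R, (0 < t)%R ->
      (((1 + t) `^ (kap * (rs^-1 - einv q)))%:E * Lweak mu w q (fun x => u x t) <= C%:E)%E.
Proof.
move=> /andP[th1 thr] del0 mu0 u00 A0 Hw muS u_ge0 uV.
have th0 : 0 < th by exact: lt_trans th1.
have r0 : 0 < rs by exact: lt_trans rs_gt1.
have thrs : 0 < th < rs by rewrite th0.
set Q := 2 `^ th / (1 - 2 `^ (th - rs)).
have Q0 : 0 < Q.
  rewrite divr_gt0 ?powR_gt0// subr_gt0.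
  by rewrite powR2_lt1// subr_lt0.
have HV x t : 0 < t -> (heat mu wkernel t (fun y => (u0 y `^ th)%:E) x <=
    ((1 + D * Q) * del `^ th * t `^ (- (kap * th / rs)))%:E)%E.
  by move=> t0; apply: (heat_sup_weak measurable_wkernel wkernel_ge0 wkernel_mass mw w_ge0 D_gt0 wkernel_sup).
pose g := kap / rs.
have g0 : 0 <= g by rewrite divr_ge0// ltW.
have K0 : 0 < (1 + D * Q) * del `^ th.
  by rewrite mulr_gt0 ?powR_gt0// ltr_wpDr// mulr_ge0 ?(ltW D_gt0) ?(ltW Q0).
pose b := 2 * ((1 + D * Q) * del `^ th) `^ th^-1.
have b0 : 0 < b by rewrite mulr_gt0 ?powR_gt0.
pose C1 := (2 * A + b) * 2 `^ g.
have C10 : 0 < C1 by rewrite mulr_gt0 ?powR_gt0// ltr_wpDl// mulr_ge0.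
have V0 x t : 0 <= fine (heat mu wkernel t (fun y => (u0 y `^ th)%:E) x).
  by apply: fine_ge0; apply: (heat_ge0 mu wkernel_ge0) => y; rewrite lee_fin powR_ge0.
have sup x t : 0 < t -> `|u x t| <= C1 * (1 + t) `^ (- g).
  move=> t0; have [h1 h2] := uV x t t0; rewrite ger0_norm//.
  apply: decay_interpolate => //.
  - by rewrite mulr_ge0.
  - exact: ltW.
  - apply: (le_trans h2); rewrite /b -mulrA ler_pM2l//.
    apply: (@le_trans _ _ (((1 + D * Q) * del `^ th * t `^ (- (kap * th / rs))) `^ th^-1)).
      rewrite ge0_ler_powR ?nnegrE ?mulr_ge0 ?powR_ge0 ?invr_ge0 ?(ltW th0)//; last exact/heat_fin/HV.
      by rewrite addr_ge0// mulr_ge0 ?(ltW D_gt0) ?(ltW Q0).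
    rewrite powRM ?powR_ge0 ?(ltW K0)// -[X in _ * X]powRrM.
    by have -> : - (kap * th / rs) * th^-1 = - g by rewrite /g; field; rewrite !gt_eqF.
have t1 t : 0 < t -> 0 < 1 + t :> R by move=> t0; rewrite addr_gt0.
case=> [q| |]//; last first.
  move=> _; exists C1 => t t0 /=; rewrite subr0.
  apply: (@le_trans _ _ (((1 + t) `^ (kap * rs^-1))%:E * (C1 * (1 + t) `^ (- g))%:E)%E).
    apply: lee_wpmul2l; first by rewrite lee_fin powR_ge0.
    by apply: Linf_le; apply: nearW => x; exact: sup.
  by rewrite -EFinM lee_fin mulrCA -powRD ?(gt_eqF (t1 t t0)) ?implybT// subrr powRr0 mulr1.
rewrite lee_fin => rq; have q0 : 0 < q by exact: lt_le_trans rq.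
(* u > l forces the flow to the power 1/th above l/2, hence the factor 2; the rs-th root absorbs the
   constant of [heat_weak_Lr] into [c]. *)
pose c := (Q * 2 `^ (rs / th)) `^ rs^-1 * (2 * del).
have c0 : 0 < c.
  apply: mulr_gt0; last exact: mulr_gt0.
  by apply: powR_gt0; apply: mulr_gt0 => //; exact: powR_gt0.
exists (C1 `^ (1 - rs / q) * c `^ (rs / q)) => t t0.
have HL l : 0 < l -> (distrib mu w (fun x => u x t) l <= ((c / l) `^ rs)%:E)%E.
  move=> l0; have l20 : 0 < l / 2 by rewrite divr_gt0.
  have -> : (c / l) `^ rs = Q * 2 `^ (rs / th) * (del / (l / 2)) `^ rs.
    have -> : c / l = (Q * 2 `^ (rs / th)) `^ rs^-1 * (del / (l / 2)) by rewrite /c; field; rewrite gt_eqF.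
    rewrite powRM ?powR_ge0 ?divr_ge0 ?(ltW del0) ?(ltW l0)// -[X in X * _]powRrM mulVf ?gt_eqF//.
    by rewrite powRr1// mulr_ge0 ?powR_ge0 ?(ltW Q0).
  apply: le_trans (heat_weak_Lr measurable_wkernel wkernel_ge0 wkernel_mass mw w_ge0 wkernel_adjoint thrs del0 t0 l20 mu0 u00 Hw).
  apply: ge0_subset_integral.
  - exact: measurable_superlevel.
  - rewrite -[X in measurable X]setTI; apply: emeasurable_fun_o_infty => //.
    apply: (measurable_heat_slice mu measurable_wkernel wkernel_ge0).
      by apply/measurable_EFinP; exact: (measurableT_comp (measurable_powR _)).
    by move=> y; rewrite lee_fin powR_ge0.
  - by apply/measurable_EFinP; exact: measurable_funTS.
  - by move=> x _; rewrite lee_fin.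
  - move=> x /=; rewrite ger0_norm// => lu.
    have [_ h2] := uV x t t0.
    have Vfin : heat mu wkernel t (fun y => (u0 y `^ th)%:E) x \is a fin_num.
      rewrite ge0_fin_numE; first exact: le_lt_trans (HV x t t0) (ltry _).
      by apply: (heat_ge0 mu wkernel_ge0) => y; rewrite lee_fin powR_ge0.
    rewrite -(fineK Vfin) lte_fin.
    have h3 : l / 2 < fine (heat mu wkernel t (fun y => (u0 y `^ th)%:E) x) `^ th^-1.
      by rewrite ltr_pdivrMr// mulrC; exact: lt_le_trans h2.
    have := gt0_ltr_powR th0 (ltW l20) (powR_ge0 _ _) h3.
    by rewrite -powRrM mulVf ?gt_eqF// powRr1.
apply: (@le_trans _ _ (((1 + t) `^ (kap * (rs^-1 - q^-1)))%:E *
   ((C1 * (1 + t) `^ (- (kap / rs))) `^ (1 - rs / q) * c `^ (rs / q))%:E)%E).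
  apply: lee_wpmul2l; first by rewrite lee_fin powR_ge0.
  apply: Lweak_le => //.
  - by rewrite r0.
  - by rewrite mulr_gt0 ?powR_gt0// t1.
  - by move=> x; exact: sup.
by rewrite -EFinM lee_fin mulrA decay_exponent// ltW.
Qed.

Lemma weak_solution th : 1 < th < p -> th < rs -> exists del : R, 0 < del /\
  forall (u0 : n.-tuple R -> R) A,
  measurable_fun setT u0 -> (forall x, 0 <= u0 x) -> 0 <= A -> (\forall x \ae mu, u0 x <= A) ->
  (forall l, 0 < l -> (\int[mu]_(y in [set y | (l < u0 y)%R]) (w y)%:E <= ((del / l) `^ rs)%:E)%E) ->
  exists u, [/\ is_solution mu w Gamma p +oo u0 u,
    (forall v, is_solution mu w Gamma p +oo u0 v ->
       forall t, 0 < t -> \forall x \ae mu, v x t = u x t),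
    forall t, measurable_fun setT (fun x => u x t),
    forall x t, 0 <= u x t &
    forall x t, 0 < t -> u x t <= 2 * A /\
      u x t <= 2 * fine (heat mu wkernel t (fun y => (u0 y `^ th)%:E) x) `^ th^-1].
Proof.
move=> /andP[th1 thp] thr.
have th0 : 0 < th by exact: lt_trans th1.
have p0 : 0 < p - 1 by rewrite subr_gt0.
set C0 := 1 + D * (2 `^ th / (1 - 2 `^ (th - rs))).
have C00 : 0 < C0.
  rewrite ltr_wpDr// mulr_ge0 ?(ltW D_gt0)// divr_ge0 ?powR_ge0// subr_ge0.
  by rewrite ltW// powR2_lt1// subr_lt0.
pose c := (th - 1) / (p - 1).
have c0 : 0 < c by rewrite divr_gt0// subr_gt0.
(* Gives equality in the hypothesis of [weak_smallness]. *)
pose K := (c / 2 `^ p) `^ (th / (p - 1)).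
have K0 : 0 < K by rewrite powR_gt0// divr_gt0// powR_gt0.
(* The threshold with C0 del^th = K, where [C0] is the constant of [heat_sup_weak]; the time
   exponents match because kap th / rs = th/(p-1). *)
exists ((K / C0) `^ th^-1); split; first by rewrite powR_gt0// divr_gt0.
move=> u0 A mu0 u00 A0 uA Hw.
apply: (@solution_exists_unique th (fun t => K * t `^ (- (th / (p - 1))))) => //.
- by rewrite !ltW.
- by apply: measurable_funM => //; exact: measurable_powR.
- by move=> t; rewrite mulr_ge0 ?powR_ge0// ltW.
- move=> x t t0.
  have thrs : 0 < th < rs by rewrite th0.
  have del0 : 0 < (K / C0) `^ th^-1 by rewrite powR_gt0// divr_gt0.
  have := heat_sup_weak measurable_wkernel wkernel_ge0 wkernel_mass mw w_ge0 D_gt0 wkernel_sup x thrs del0 t0 mu0 u00 Hw.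
  rewrite -/C0 -powRrM mulVf ?gt_eqF// powRr1 ?divr_ge0 ?(ltW K0) ?(ltW C00)//.
  have -> : C0 * (K / C0) = K by field; rewrite gt_eqF.
  by have -> : kap * th / rs = th / (p - 1) by rewrite /rs; field; rewrite !gt_eqF.
- apply: weak_smallness.
  + by rewrite th1.
  + exact: ltW.
  + rewrite /K -powRrM.
    have -> : th / (p - 1) * ((p - 1) / th) = 1 by field; rewrite !gt_eqF.
    have cp : 0 <= c / 2 `^ p by rewrite divr_ge0 ?powR_ge0// ltW.
    by rewrite (powRr1 cp) divfK// gt_eqF// powR_gt0.
Qed.

Lemma strong_solution r : 1 <= r < rs -> exists del : R, 0 < del /\
  forall (u0 : n.-tuple R -> R) A L,
  measurable_fun setT u0 -> (forall x, 0 <= u0 x) -> 0 <= A -> (\forall x \ae mu, u0 x <= A) ->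
  0 <= L -> (\int[mu]_y (u0 y `^ r * w y)%:E <= (L `^ r)%:E)%E ->
  L `^ (r / rs) * A `^ (1 - r / rs) < del ->
  exists u, [/\ is_solution mu w Gamma p +oo u0 u,
    (forall v, is_solution mu w Gamma p +oo u0 v ->
       forall t, 0 < t -> \forall x \ae mu, v x t = u x t),
    forall t, measurable_fun setT (fun x => u x t),
    forall x t, 0 <= u x t &
    forall x t, 0 < t -> u x t <= 2 * A /\
      u x t <= 2 * fine (heat mu wkernel t (fun y => (u0 y `^ 1)%:E) x) `^ 1^-1].
Proof.
move=> /andP[r1 rrs].
have r0 : 0 < r by exact: lt_le_trans r1.
have p0 : 0 < p - 1 by rewrite subr_gt0.
have rs0 : 0 < rs by exact: lt_trans rs_gt1.
(* In these terms the smoothing rate kap/r is sig/(p-1), the rate in [strong_smallness]. *)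
pose sig := rs / r.
have sig1 : 1 < sig by rewrite ltr_pdivlMr// mul1r.
have sig0 : 0 < sig by exact: lt_trans sig1.
(* The bound of [strong_smallness] divided by the power of [D] contained in G^(p-1). *)
pose E := (sig - 1) * 2 `^ (- ((p + 1) * sig)) / D `^ ((p - 1) / r).
have E0 : 0 < E by rewrite divr_gt0 ?powR_gt0// mulr_gt0 ?powR_gt0// subr_gt0.
exists (E `^ ((p - 1) * sig)^-1); split; first by rewrite powR_gt0.
move=> u0 A L mu0 u00 A0 uA L0 HL Hdel.
pose G := (D * L `^ r) `^ r^-1.
have G0 : 0 <= G by rewrite powR_ge0.
have mB : measurable_fun setT (fun t => Num.min A (G * t `^ (- (sig / (p - 1))))).
  apply: measurable_minr => //; apply: measurable_funM => //; exact: measurable_powR.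
apply: (@solution_exists_unique 1 (fun t => Num.min A (G * t `^ (- (sig / (p - 1)))))) => //.
- by rewrite lexx ltW.
- by move=> t; rewrite le_min A0 mulr_ge0 ?powR_ge0.
- move=> x t t0; rewrite EFin_min le_min; apply/andP; split.
    apply: (heat_le_cst measurable_wkernel wkernel_ge0 wkernel_mass) => //.
    + by apply/measurable_EFinP; exact: (measurableT_comp (measurable_powR _)).
    + by move=> y; rewrite lee_fin powR_ge0.
    + by apply: filterS uA => y; rewrite lee_fin powRr1.
  have := heat_sup_Lr measurable_wkernel wkernel_ge0 wkernel_mass mw w_ge0 D_gt0 wkernel_sup x ltr01 r1 t0 mu0 u00 (powR_ge0 _ _) HL.
  have -> : D * t `^ (- kap) * L `^ r = D * L `^ r * t `^ (- kap) by ring.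
  rewrite powRM ?mulr_ge0 ?powR_ge0 ?(ltW D_gt0)// -[in X in _ -> X]/G div1r -/G -[t `^ _ `^ _]powRrM.
  by have -> : - kap * r^-1 = - (sig / (p - 1)) by rewrite /sig /rs; field; rewrite !gt_eqF.
- move=> t t0; rewrite invr1 subrr powRr0 !mulr1.
  apply: strong_smallness => //.
  have -> : G `^ (p - 1) = D `^ ((p - 1) / r) * L `^ (p - 1).
    rewrite /G -powRrM powRM ?powR_ge0 ?(ltW D_gt0)// -[L `^ r `^ _]powRrM.
    by congr (_ `^ _ * _ `^ _); field; rewrite gt_eqF.
  have h : L `^ (p - 1) * A `^ ((p - 1) * (sig - 1)) <= E.
    have hE : E = (E `^ ((p - 1) * sig)^-1) `^ ((p - 1) * sig).
      by rewrite -powRrM mulVf ?powRr1 ?(ltW E0)// gt_eqF// mulr_gt0.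
    (* The product of norms in the theorem, raised to the power (p-1) sig, is the quantity that has
       to be at most [E]; this dictates both the product and the threshold. *)
    have -> : L `^ (p - 1) * A `^ ((p - 1) * (sig - 1)) = (L `^ (r / rs) * A `^ (1 - r / rs)) `^ ((p - 1) * sig).
      rewrite powRM ?powR_ge0// -!powRrM; congr (_ `^ _ * _ `^ _); rewrite /sig; field; rewrite !gt_eqF//.
    have ps0 : 0 <= (p - 1) * sig by rewrite ltW// mulr_gt0.
    rewrite hE; apply: ge0_ler_powR => //; last exact: ltW.
    - by rewrite nnegrE mulr_ge0 ?powR_ge0.
    - by rewrite nnegrE powR_ge0.
  by rewrite -mulrA mulrC -ler_pdivlMr ?powR_gt0.
Qed.

Lemma weak_global_existence : exists del : R, 0 < del /\
  forall u0 : n.-tuple R -> R, measurable_fun setT u0 -> (forall x, 0 <= u0 x) ->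
  (Linf mu u0 < +oo)%E -> (Lweak mu w rs%:E u0 < del%:E)%E ->
  exists u : n.-tuple R -> R -> R,
    is_solution mu w Gamma p +oo u0 u /\
    (forall v, is_solution mu w Gamma p +oo u0 v ->
       forall t, 0 < t -> \forall x \ae mu, v x t = u x t) /\
    (forall q : \bar R, (rs%:E <= q)%E ->
       exists C : R, forall t : R, (0 < t)%R ->
         ((1 + t) `^ (kap * (rs^-1 - einv q)))%:E * Lweak mu w q (fun x => u x t) <= C%:E)%E.
Proof.
(* The midpoint of 1 and min(p, rs), which exceeds 1 because both entries do. *)
pose th := (1 + Num.min p rs) / 2.
have [th1 thp thr] : [/\ 1 < th, th < p & th < rs].
  have m1 : 1 < Num.min p rs by rewrite lt_min p_gt1.
  have [mp mr] : Num.min p rs <= p /\ Num.min p rs <= rs by rewrite !ge_min !lexx orbT.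
  by rewrite /th; split; lra.
have rs0 : 0 < rs by exact: lt_trans rs_gt1.
have [|del [del0 H]] := @weak_solution th _ thr; first by rewrite th1.
exists del; split => // u0 mu0 u00 uL uW.
have A0 := fine_Linf_ge0 uL.
have uA : \forall x \ae mu, u0 x <= fine (Linf mu u0).
  by apply: filterS (ae_le_Linf uL) => x; apply: le_trans; exact: ler_norm.
have Hw l : 0 < l -> (\int[mu]_(y in [set y | (l < u0 y)%R]) (w y)%:E <= ((del / l) `^ rs)%:E)%E.
  move=> l0; have := distrib_le_of_Lweak mw w_ge0 rs0 del0 mu0 uW l0.
  rewrite /distrib /wmeas.
  by have -> : [set x | l < `|u0 x|] = [set y | l < u0 y]
    by apply/seteqP; split => x /=; rewrite ger0_norm.
have [u [us uu um upos ub]] := H u0 _ mu0 u00 A0 uA Hw.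
exists u; split => //; split => //.
by apply: (@weak_decay th del u0 u (fine (Linf mu u0))) => //; rewrite th1.
Qed.

(** At r = rs the sup norm drops out of the smallness condition and the time integral bound with th
    = 1 is lost. Existence then comes from regarding the data as weak L^(rs) data, while the decay
    in strong norms comes from [strong_decay] with the same th > 1. *)
Lemma strong_global_existence r : 1 <= r <= rs -> exists del : R, 0 < del /\
  forall u0 : n.-tuple R -> R, measurable_fun setT u0 -> (forall x, 0 <= u0 x) ->
  (Linf mu u0 < +oo)%E -> (Lw mu w r%:E u0 < +oo)%E ->
  (fine (Lw mu w r%:E u0)) `^ (r / rs) * (fine (Linf mu u0)) `^ (1 - r / rs) < del ->
  exists u : n.-tuple R -> R -> R,
    is_solution mu w Gamma p +oo u0 u /\
    (forall v, is_solution mu w Gamma p +oo u0 v ->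
       forall t, 0 < t -> \forall x \ae mu, v x t = u x t) /\
    (forall q : \bar R, (r%:E <= q)%E ->
       exists C : R, forall t : R, (0 < t)%R ->
         ((1 + t) `^ (kap * (r^-1 - einv q)))%:E * Lw mu w q (fun x => u x t) <= C%:E)%E.
Proof.
move=> /andP[r1 rrs].
have r0 : 0 < r by exact: lt_le_trans r1.
have rs0 : 0 < rs by exact: lt_trans rs_gt1.
have data (u0 : n.-tuple R -> R) : (forall x, 0 <= u0 x) -> (Linf mu u0 < +oo)%E -> (Lw mu w r%:E u0 < +oo)%E ->
    [/\ 0 <= fine (Lw mu w r%:E u0),
     (\int[mu]_y (u0 y `^ r * w y)%:E <= (fine (Lw mu w r%:E u0) `^ r)%:E)%E,
     0 <= fine (Linf mu u0) & \forall x \ae mu, u0 x <= fine (Linf mu u0)].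
  move=> u00 uL uW.
  pose I := (\int[mu]_x (`|u0 x| `^ r * w x)%:E)%E.
  have LE : Lw mu w r%:E u0 = poweR I r^-1 by [].
  have IE : (\int[mu]_y (u0 y `^ r * w y)%:E)%E = I.
    by apply: eq_integral => x _; rewrite ger0_norm.
  have I0 : (0 <= I)%E.
    by apply: integral_ge0 => x _; rewrite lee_fin mulr_ge0 ?powR_ge0.
  have rN0 : r^-1 != 0 by rewrite invr_eq0 gt_eqF.
  rewrite LE IE in uW *; clearbody I.
  have Ifin : I \is a fin_num by rewrite (ge0_fin_numE I0); exact: lty_poweRy uW.
  split.
  - by rewrite fine_poweR powR_ge0.
  - rewrite fine_poweR -powRrM mulVf ?gt_eqF// powRr1 ?fine_ge0// fineK//.
  - exact: fine_Linf_ge0.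
  - by apply: filterS (ae_le_Linf uL) => x; apply: le_trans; exact: ler_norm.
move: rrs; rewrite le_eqVlt => /orP[/eqP rE|rrs]; last first.
  have [|del [del0 H]] := @strong_solution r; first by rewrite r1.
  exists del; split => // u0 mu0 u00 uL uW hdel.
  have [L0 HL A0 uA] := data u0 u00 uL uW.
  have [u [us uu um upos ub]] := H u0 _ _ mu0 u00 A0 uA L0 HL hdel.
  exists u; split => //; split => //.
  apply: (@strong_decay r 1 u0 u (fine (Lw mu w r%:E u0) `^ r) (fine (Linf mu u0))) => //.
  - by rewrite lexx.
  - exact: powR_ge0.
pose th := (1 + Num.min p rs) / 2.
have [th1 thp thr] : [/\ 1 < th, th < p & th < rs].
  have m1 : 1 < Num.min p rs by rewrite lt_min p_gt1.
  have [mp mr] : Num.min p rs <= p /\ Num.min p rs <= rs by rewrite !ge_min !lexx orbT.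
  by rewrite /th; split; lra.
have [|del [del0 H]] := @weak_solution th _ thr; first by rewrite th1.
exists del; split => // u0 mu0 u00 uL uW.
have [L0 HL A0 uA] := data u0 u00 uL uW.
rewrite -rE divff ?gt_eqF// subrr powRr0 mulr1 powRr1// => hdel.
have Hw l : 0 < l -> (\int[mu]_(y in [set y | (l < u0 y)%R]) (w y)%:E <= ((del / l) `^ rs)%:E)%E.
  move=> l0; have : (distrib mu w u0 l <= ((del / l) `^ r)%:E)%E.
    apply: (chebyshev_distrib mw w_ge0 r0 (ltW del0) mu0) => //.
    apply: (@le_trans _ _ (\int[mu]_y (u0 y `^ r * w y)%:E)%E).
      by rewrite le_eqVlt; apply/orP; left; apply/eqP; apply: eq_integral => x _; rewrite ger0_norm.
    apply: (le_trans HL); rewrite lee_fin ge0_ler_powR ?nnegrE ?(ltW r0)//; exact: ltW.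
  rewrite -rE /distrib /wmeas.
  by have -> : [set x | l < `|u0 x|] = [set y | l < u0 y]
    by apply/seteqP; split => x /=; rewrite ger0_norm.
have [u [us uu um upos ub]] := H u0 _ mu0 u00 A0 uA Hw.
exists u; split => //; split => //.
apply: (@strong_decay r th u0 u (fine (Lw mu w r%:E u0) `^ r) (fine (Linf mu u0))) => //.
- by rewrite ltW//= rE ltW.
- exact: powR_ge0.
Qed.
End cauchy_problem.

(** * Passing to a bundled sigma-finite measure *)

Section sigma_finite_copy.
Context d (T : measurableType d) (R : realType) (mu : {measure set T -> \bar R}).

(** An alias of [mu] that takes the proof of sigma-finiteness as an argument, so that the
    corresponding structure can be attached to it. *)
Definition sigma_finite_copy of sigma_finite setT mu : set T -> \bar R := mu.

Variable mu_sf : sigma_finite setT mu.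
HB.instance Definition _ := Measure.copy (sigma_finite_copy mu_sf) (mu : set T -> \bar R).
HB.instance Definition _ := Measure_isSigmaFinite.Build _ _ _ (sigma_finite_copy mu_sf) mu_sf.

End sigma_finite_copy.

(** Equality of bundled measures, not merely of their values, allows the given [mu] to be
    substituted throughout a statement. *)
Lemma sigma_finite_measure_ex d (T : measurableType d) (R : realType)
    (mu : {measure set T -> \bar R}) : sigma_finite setT mu ->
  exists mus : {sigma_finite_measure set T -> \bar R}, (mus : {measure set T -> \bar R}) = mu.
Proof. by move=> sf; exists (sigma_finite_copy sf); case: mu sf => m [c1 c2] sf. Qed.

Theorem theorem1p2 (R : realType) (n : nat) (caseA : bool) (alpha p : R)
  (mu : {measure set (n.-tuple R) -> \bar R})
  (Gamma : n.-tuple R -> n.-tuple R -> R -> R) :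
  (1 <= n)%N -> 0 <= alpha ->
  (if caseA then alpha < 1 else alpha < n%:R) ->
  is_lebesgue_Rn mu ->
  kernel_assumptions mu (weight caseA alpha) Gamma ->
  1 + 2 / (n%:R + alpha) < p ->
  let w := weight caseA alpha in
  let rs := (n%:R + alpha) / 2 * (p - 1) in
  (* (i) *)
  (exists delta : R, 0 < delta /\
    forall u0 : n.-tuple R -> R,
      measurable_fun [set: n.-tuple R] u0 ->
      (forall x, 0 <= u0 x) ->
      (Linf mu u0 < +oo)%E ->
      (Lweak mu w rs%:E u0 < delta%:E)%E ->
      exists u : n.-tuple R -> R -> R,
        is_solution mu w Gamma p +oo u0 u /\
        (forall v, is_solution mu w Gamma p +oo u0 v ->
           forall t, 0 < t -> \forall x \ae mu, v x t = u x t) /\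
        (forall q : \bar R, (rs%:E <= q)%E ->
           exists C : R, forall t : R, (0 < t)%R ->
             ((1 + t) `^ ((n%:R + alpha) / 2 * (rs^-1 - einv q)))%:E
               * Lweak mu w q (fun x => u x t) <= C%:E)%E) /\
  (* (ii) *)
  (forall r : R, 1 <= r <= rs ->
   exists delta : R, 0 < delta /\
    forall u0 : n.-tuple R -> R,
      measurable_fun [set: n.-tuple R] u0 ->
      (forall x, 0 <= u0 x) ->
      (Linf mu u0 < +oo)%E ->
      (Lw mu w r%:E u0 < +oo)%E ->
      (fine (Lw mu w r%:E u0)) `^ (r / rs) * (fine (Linf mu u0)) `^ (1 - r / rs)
        < delta ->
      exists u : n.-tuple R -> R -> R,
        is_solution mu w Gamma p +oo u0 u /\
        (forall v, is_solution mu w Gamma p +oo u0 v ->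
           forall t, 0 < t -> \forall x \ae mu, v x t = u x t) /\
        (forall q : \bar R, (r%:E <= q)%E ->
           exists C : R, forall t : R, (0 < t)%R ->
             ((1 + t) `^ ((n%:R + alpha) / 2 * (r^-1 - einv q)))%:E
               * Lw mu w q (fun x => u x t) <= C%:E)%E).
Proof.
move=> n1 a0 aub mleb KA pgt w rs.
have [mus muE] := sigma_finite_measure_ex (lebesgue_Rn_sigma_finite mleb).
subst mu.
have n0 : 0 < n%:R :> R by rewrite ltr0n.
have na : 0 < n%:R + alpha by rewrite ltr_wpDr.
have p1 : 1 < p by apply: lt_trans pgt; rewrite ltrDl divr_gt0.
have kap0 : 0 < (n%:R + alpha) / 2 by rewrite divr_gt0.
(* The supercritical condition on [p] is a rearrangement of rs > 1. *)
have rs1 : 1 < rs.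
  rewrite /rs mulrC -ltr_pdivrMr// div1r invf_div; lra.
have [D [D0 GD]] := heat_kernel_bound mleb n1 a0 KA.
have mw : measurable_fun setT w by exact: measurable_weight.
have w0 x : 0 <= w x by exact: weight_ge0.
split; first exact: (@weak_global_existence R n mus w Gamma p D _ mw w0 KA D0 kap0 GD p1 rs1).
by move=> r hr; exact: (@strong_global_existence R n mus w Gamma p D _ mw w0 KA D0 kap0 GD p1 rs1 r hr).
Qed.
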